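(* Let $\mathcal{HV}$ be the Heisenberg-Virasoro conformal algebra, i.e. the Lie conformal algebra over $\mathbb{C}$ that is free of rank $2$ as a $\mathbb{C}[\partial]$-module with basis $\{L,M\}$ and with $\lambda$-brackets $$[L_\lambda L]=(\partial+2\lambda)L,\quad [L_\lambda M]=(\partial+\lambda)M,\quad [M_\lambda L]=\lambda M,\quad [M_\lambda M]=0.$$ For an $\mathcal{HV}$-module $V$, let $\tilde{\mathrm H}^\bullet(\mathcal{HV},V)$ denote its basic cohomology and $\mathrm H^\bullet(\mathcal{HV},V)$ its reduced cohomology. Then the following statements hold. (1) For the trivial module $\mathbb{C}$ and integers $q\ge 0$, $$\dim \tilde{\mathrm H}^q(\mathcal{HV},\mathbb{C})=\begin{cases}1 & \text{if } q=0,\\ 3 & \text{if } q=3,\\ 2 & \text{if } q=4,\\ 0 & \text{otherwise,}\end{cases}\qquad \dim \mathrm H^q(\mathcal{HV},\mathbb{C})=\begin{cases}1 & \text{if } q=0,\\ 3 & \text{if } q=2,\\ 5 & \text{if } q=3,\\ 2 & \text{if } q=4,\\ 0 & \text{otherwise.}\end{cases}$$ (2) If $a\in\mathbb{C}$ and $a\neq 0$, then $\mathrm H^q(\mathcal{HV},\mathbb{C}_a)=0$ for all $q\ge 0$. (3) If $\Delta,\alpha\in\mathbb{C}$ and $\alpha\neq 0$, then $\mathrm H^q(\mathcal{HV},M_{\Delta,\alpha})=0$ for all $q\ge 0$.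
   Context: All vector spaces and tensor products are over $\mathbb{C}$. **Lie conformal algebras.** A Lie conformal algebra $\mathcal{A}$ is a $\mathbb{C}[\partial]$-module with a $\mathbb{C}$-bilinear map $\mathcal{A}\otimes\mathcal{A}\to\mathbb{C}[\lambda]\otimes\mathcal{A}$, $a\otimes b\mapsto[a_\lambda b]$, such that for all $a,b,c\in\mathcal{A}$: $[\partial a_\lambda b]=-\lambda[a_\lambda b]$ and $[a_\lambda\partial b]=(\partial+\lambda)[a_\lambda b]$ (conformal sesquilinearity); $[a_\lambda b]=-[b_{-\lambda-\partial}a]$ (skew-symmetry); $[a_\lambda[b_\mu c]]=[[a_\lambda b]_{\lambda+\mu}c]+[b_\mu[a_\lambda c]]$ (Jacobi identity). By sesquilinearity the brackets of generators determine all brackets. **Modules.** A (conformal) module $V$ over $\mathcal{A}$ is a $\mathbb{C}[\partial]$-module with a $\mathbb{C}$-bilinear map $\mathcal{A}\otimes V\to V[\lambda]$, $a\otimes v\mapsto a_\lambda v$, such that for all $a,b\in\mathcal{A}$, $v\in V$: $a_\lambda(b_\mu v)-b_\mu(a_\lambda v)=[a_\lambda b]_{\lambda+\mu}v$, $(\partial a)_\lambda v=-\lambda a_\lambda v$, and $a_\lambda(\partial v)=(\partial+\lambda)a_\lambda v$. **The modules considered.** - The trivial module $\mathbb{C}$: both $\partial$ and $\mathcal{HV}$ act by zero. - $\mathbb{C}_a$, for $a\in\mathbb{C}$, $a\neq0$: the vector space $\mathbb{C}$ with $\partial v=av$ and with $\mathcal{HV}$ acting by zero. - $M_{\Delta,\alpha}=\mathbb{C}[\partial]v$,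 for $\Delta,\alpha\in\mathbb{C}$: the free $\mathbb{C}[\partial]$-module of rank $1$ with $L_\lambda v=(\partial+\alpha+\Delta\lambda)v$ and $M_\lambda v=0$. **Cochains.** For $n\ge1$, an $n$-cochain of $\mathcal{A}$ with coefficients in an $\mathcal{A}$-module $V$ is a $\mathbb{C}$-linear map $\gamma:\mathcal{A}^{\otimes n}\to V[\lambda_1,\dots,\lambda_n]$, $a_1\otimes\cdots\otimes a_n\mapsto\gamma_{\lambda_1,\dots,\lambda_n}(a_1,\dots,a_n)$, such that (i) $\gamma_{\lambda_1,\dots,\lambda_n}(a_1,\dots,\partial a_i,\dots,a_n)=-\lambda_i\gamma_{\lambda_1,\dots,\lambda_n}(a_1,\dots,a_n)$ for each $i$, and (ii) $\gamma$ is skew-symmetric with respect to simultaneous permutations of the $a_i$'s and the $\lambda_i$'s. A $0$-cochain is an element of $V$. The space of $n$-cochains is denoted $\tilde C^n(\mathcal{A},V)$. **Differential.** For an $n$-cochain $\gamma$, $$(d\gamma)_{\lambda_1,\dots,\lambda_{n+1}}(a_1,\dots,a_{n+1})=\sum_{i=1}^{n+1}(-1)^{i+1}{a_i}_{\lambda_i}\gamma_{\lambda_1,\dots,\hat{\lambda_i},\dots,\lambda_{n+1}}(a_1,\dots,\hat{a_i},\dots,a_{n+1})$$ $$+\sum_{1\le i<j\le n+1}(-1)^{i+j}\gamma_{\lambda_i+\lambda_j,\lambda_1,\dots,\hat{\lambda_i},\dots,\hat{\lambda_j},\dots,\lambda_{n+1}}([{a_i}_{\lambda_i}a_j],a_1,\dots,\hat{a_i},\dots,\hat{a_j},\dots,a_{n+1}),$$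 where $\gamma$ is extended linearly over polynomials in the $\lambda_i$ and hats denote omission. For a $0$-cochain $\gamma\in V$, $(d\gamma)_\lambda(a)=a_\lambda\gamma$. The map $d$ sends cochains to cochains and $d^2=0$. **Basic and reduced cohomology.** The basic complex is $\tilde C^\bullet(\mathcal{A},V)=\bigoplus_{n\ge0}\tilde C^n(\mathcal{A},V)$ with differential $d$; its cohomology is the basic cohomology $\tilde{\mathrm H}^\bullet(\mathcal{A},V)$. Let $\partial$ act on $\tilde C^n(\mathcal{A},V)$ by $(\partial\gamma)_{\lambda_1,\dots,\lambda_n}(a_1,\dots,a_n)=(\partial_V+\sum_{i=1}^n\lambda_i)\gamma_{\lambda_1,\dots,\lambda_n}(a_1,\dots,a_n)$, where $\partial_V$ is the action of $\partial$ on $V$ (so $\partial$ acts as $\partial_V$ on $\tilde C^0=V$). Then $d\partial=\partial d$, so $\partial\tilde C^\bullet(\mathcal{A},V)$ is a subcomplex; the quotient $C^\bullet(\mathcal{A},V)=\tilde C^\bullet(\mathcal{A},V)/\partial\tilde C^\bullet(\mathcal{A},V)$ is the reduced complex, and its cohomology is the reduced cohomology $\mathrm H^\bullet(\mathcal{A},V)$. *)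

(* Defs.v *)
From HB Require Import structures.
From mathcomp Require Import all_boot all_order all_algebra all_fingroup.
From mathcomp Require Import boolp classical_sets functions reals complex ring.
Set Implicit Arguments.
Unset Strict Implicit.
Unset Printing Implicit Defensive.
Import Order.TTheory GRing.Theory Num.Theory.
Local Open Scope classical_set_scope.
Local Open Scope ring_scope.

(* The indeterminates lambda_i are treated as scalar variables: the ground    *)
(* field K is infinite (characteristic 0), so V[lambda_1,...,lambda_n] is the *)
(* space of polynomial functions K^n -> V.  The lemma [polyfun_coef_inj]      *)
(* below shows that no information is lost: a polynomial function determines  *)
(* all its coefficients in V.                                                 *)
Section PolynomialFunctions.
Variables (K : numFieldType) (V : lmodType K).

Definition polysum1 (N : nat) (c : nat -> V) (x : K) : V :=
  \sum_(k < N) x ^+ k *: c k.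

Definition polyfun1 (f : K -> V) : Prop :=
  exists N (c : nat -> V), forall x, f x = polysum1 N c x.

(* Multi-exponents with every component < N are functions 'I_n -> 'I_N.       *)
Definition polysum n (N : nat) (c : {ffun 'I_n -> 'I_N} -> V) (x : 'I_n -> K) : V :=
  \sum_(m : {ffun 'I_n -> 'I_N}) (\prod_(i < n) x i ^+ m i) *: c m.

Definition polyfun n (f : ('I_n -> K) -> V) : Prop :=
  exists N (c : {ffun 'I_n -> 'I_N} -> V), forall x, f x = polysum c x.

Lemma sparse_coef_inj (T : finType) (e : T -> nat) (c : T -> V) :
  injective e -> (forall t : K, \sum_m t ^+ e m *: c m = 0) ->
  forall m, c m = 0.
Proof.
move=> e_inj c0 m0.
pose D := (\max_m e m).+1.
have ltD m : (e m < D)%N by rewrite ltnS; apply: leq_bigmax.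
pose M : 'M[K]_D := Vandermonde D (\row_(j < D) (j%:R : K)).
have uM : M \in unitmx.
  rewrite unitmxE det_Vandermonde unitfE.
  apply/prodf_neq0 => i _; apply/prodf_neq0 => j ltij.
  by rewrite !mxE subr_eq0 eqr_nat eq_sym ltn_eqF.
have MV (k k0 : 'I_D) : \sum_(j < D) (j%:R : K) ^+ k * invmx M j k0 = (k == k0)%:R.
  have := congr1 (fun A : 'M[K]_D => A k k0) (mulmxV uM).
  by rewrite !mxE => <-; apply: eq_bigr => j _; rewrite !mxE.
pose k0 := Ordinal (ltD m0).
have : \sum_(j < D) invmx M j k0 *: (\sum_m (j%:R : K) ^+ e m *: c m) = 0.
  by apply: big1 => j _; rewrite c0 scaler0.
under eq_bigr => j _ do rewrite scaler_sumr.
rewrite exchange_big /= => H; rewrite -{}[RHS]H (bigD1 m0) //=.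
have S m : \sum_(j < D) invmx M j k0 *: ((j%:R : K) ^+ e m *: c m)
           = (m == m0)%:R *: c m.
  under eq_bigr => j _ do rewrite scalerA mulrC.
  rewrite -scaler_suml (MV (Ordinal (ltD m)) k0); congr (_%:R *: _).
  by rewrite -val_eqE /= (inj_eq e_inj).
rewrite S eqxx scale1r big1 ?addr0 // => m /negbTE mm0.
by rewrite S mm0 scale0r.
Qed.

Lemma radix_inj n N (m m' : 'I_n -> 'I_N) :
  (\sum_(i < n) m i * N ^ i = \sum_(i < n) m' i * N ^ i)%N -> m =1 m'.
Proof.
elim: n m m' => [|n IHn] m m' ; first by move=> _ [].
rewrite !big_ord_recl /= !expn0 !muln1.
have S (u : 'I_n.+1 -> 'I_N) : (\sum_(i < n) u (lift ord0 i) * N ^ bump 0 i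
    = N * \sum_(i < n) u (lift ord0 i) * N ^ i)%N.
  by rewrite big_distrr; apply: eq_bigr => i _; rewrite /bump /= expnS mulnCA.
have N0 : (0 < N)%N by case: (m ord0) => k; apply: leq_ltn_trans.
rewrite !S => E.
have E0 : m ord0 = m' ord0.
  apply: val_inj; have := congr1 (modn^~ N) E.
  by rewrite /= !(addnC (nat_of_ord _)) !(mulnC N) !modnMDl !modn_small.
move: E; rewrite E0 => /addnI /eqP; rewrite eqn_pmul2l // => /eqP E i.
have [-> //|[j ->]] : i = ord0 \/ exists j, i = lift ord0 j.
  by case: (unliftP ord0 i) => [j ->|->]; [right; exists j | left].
exact: (IHn (fun i => m (lift ord0 i)) (fun i => m' (lift ord0 i)) E).
Qed.

Lemma polyfun_coef_inj n N (c c' : {ffun 'I_n -> 'I_N} -> V) :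
  polysum c =1 polysum c' -> c =1 c'.
Proof.
move=> E m; apply/eqP; rewrite -subr_eq0; apply/eqP; move: m.
apply: (@sparse_coef_inj _ (fun m : {ffun 'I_n -> 'I_N} => \sum_(i < n) m i * N ^ i)%N).
  by move=> m m' /radix_inj mm'; apply/ffunP.
move=> t; have := E (fun i => t ^+ (N ^ i)); move/eqP.
rewrite -subr_eq0 /polysum -sumrB => /eqP Z; rewrite -[RHS]Z; apply: eq_bigr => m _.
rewrite scalerBr; suff -> : t ^+ (\sum_(i < n) m i * N ^ i)
    = \prod_(i < n) (t ^+ (N ^ i)) ^+ m i by [].
by rewrite -prodrXr; apply: eq_bigr => i _; rewrite -exprM mulnC.
Qed.

End PolynomialFunctions.

(* A C[partial]-module is an lmodType with a linear endomorphism [lca_der].   *)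
(* [lca_br x a b] is [a_x b].  The right-hand side [b_{-x-partial} a] of      *)
(* skew-symmetry is obtained by writing [b_y a] = \sum_k y^k c_k and          *)
(* substituting for y the operator -x-partial acting on the coefficients c_k. *)
Record lieConformal (K : numFieldType) := LieConformal {
  lca_sort :> lmodType K;
  lca_der : {linear lca_sort -> lca_sort};
  lca_br : K -> lca_sort -> lca_sort -> lca_sort;
  lca_br_poly : forall a b, polyfun1 (fun x => lca_br x a b);
  lca_br_linl : forall x k a a' b,
    lca_br x (k *: a + a') b = k *: lca_br x a b + lca_br x a' b;
  lca_br_linr : forall x k a b b',
    lca_br x a (k *: b + b') = k *: lca_br x a b + lca_br x a b';
  lca_br_derl : forall x a b, lca_br x (lca_der a) b = - (x *: lca_br x a b);
  lca_br_derr : forall x a b,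
    lca_br x a (lca_der b) = lca_der (lca_br x a b) + x *: lca_br x a b;
  lca_br_skew : forall a b N (c : nat -> lca_sort),
    (forall y, lca_br y b a = polysum1 N c y) ->
    forall x, lca_br x a b =
      - \sum_(k < N) iter k (fun u => - (x *: u) - lca_der u) (c k);
  lca_br_jacobi : forall x y a b c,
    lca_br x a (lca_br y b c) =
      lca_br (x + y) (lca_br x a b) c + lca_br y b (lca_br x a c)
}.
Arguments lca_der {K l}.

Record lcaModule (K : numFieldType) (A : lieConformal K) := LcaModule {
  lcm_sort :> lmodType K;
  lcm_der : {linear lcm_sort -> lcm_sort};
  lcm_act : K -> A -> lcm_sort -> lcm_sort;
  lcm_act_poly : forall a v, polyfun1 (fun x => lcm_act x a v);
  lcm_act_linl : forall x k a a' v,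
    lcm_act x (k *: a + a') v = k *: lcm_act x a v + lcm_act x a' v;
  lcm_act_linr : forall x k a v v',
    lcm_act x a (k *: v + v') = k *: lcm_act x a v + lcm_act x a v';
  lcm_act_br : forall x y a b v,
    lcm_act x a (lcm_act y b v) - lcm_act y b (lcm_act x a v) =
      lcm_act (x + y) (lca_br x a b) v;
  lcm_act_derl : forall x a v,
    lcm_act x (lca_der a) v = - (x *: lcm_act x a v);
  lcm_act_derr : forall x a v,
    lcm_act x a (lcm_der v) = lcm_der (lcm_act x a v) + x *: lcm_act x a v
}.
Arguments lcm_der {K A l}.

(* The space num / den, for subspaces den of num (both inside W).             *)
Record subquotient (K : numFieldType) (W : lmodType K) := Subquotient {
  num : set W;
  den : set W
}.

(* The classes of e_0, ..., e_{n-1} form a basis of num / den.                *)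
Definition has_dim (K : numFieldType) (W : lmodType K) (H : subquotient W)
    (n : nat) : Prop :=
  exists e : 'I_n -> W,
    [/\ forall i, num H (e i),
        forall k : 'I_n -> K, den H (\sum_i k i *: e i) -> forall i, k i = 0
      & forall w, num H w -> exists k : 'I_n -> K, den H (w - \sum_i k i *: e i)].

Definition is_zero (K : numFieldType) (W : lmodType K) (H : subquotient W) : Prop :=
  num H `<=` den H.

Section Cohomology.
Variables (K : numFieldType) (A : lieConformal K) (V : lcaModule A).

(* [g a x] is g_{x_0,...,x_{n-1}}(a_0,...,a_{n-1}).                           *)
Definition precochain (n : nat) : lmodType K := ('I_n -> A) -> ('I_n -> K) -> V.

Record cochain n (g : precochain n) : Prop := Cochain {
  cochain_poly : forall a, polyfun (g a);
  cochain_linear : forall (i : 'I_n) (k : K) (u v : A) (a : 'I_n -> A) x,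
    g [eta a with i |-> k *: u + v] x =
      k *: g [eta a with i |-> u] x + g [eta a with i |-> v] x;
  cochain_der : forall (i : 'I_n) (a : 'I_n -> A) x,
    g [eta a with i |-> lca_der (a i)] x = - (x i *: g a x);
  cochain_skew : forall (s : 'S_n) (a : 'I_n -> A) (x : 'I_n -> K),
    g (a \o s) (x \o s) = (-1) ^+ s *: g a x
}.

Definition fcons T n (t : T) (f : 'I_n -> T) : 'I_n.+1 -> T :=
  fun i => if unlift ord0 i is Some j then f j else t.

Definition diff_act n (g : precochain n) : precochain n.+1 := fun a x =>
  \sum_(i < n.+1) (-1) ^+ i *:
    lcm_act (x i) (a i) (g (a \o lift i) (x \o lift i)).

(* The pairs i < j in 'I_n.+2 are the pairs (i, lift i j') with i <= j', and  *)
(* [lift i \o lift j'] enumerates increasingly the indices other than i, j.   *)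
Definition diff_br n (g : precochain n.+1) : precochain n.+2 := fun a x =>
  \sum_(i < n.+2) \sum_(j' < n.+1 | (i <= j')%N) let j := lift i j' in
    (-1) ^+ (i + j) *:
      g (fcons (lca_br (x i) (a i) (a j)) (a \o lift i \o lift j'))
        (fcons (x i + x j) (x \o lift i \o lift j')).

Definition diff n : precochain n -> precochain n.+1 :=
  match n with
  | 0 => fun g => diff_act g
  | n'.+1 => fun g => diff_act g + diff_br g
  end.

Definition cochain_partial n (g : precochain n) : precochain n := fun a x =>
  lcm_der (g a x) + (\sum_i x i) *: g a x.

(* Cohomology of the quotient of the complex of cochains by a subcomplex S:   *)
(* cocycles are the cochains g with d g in S, coboundaries the cochains lying *)
(* in d(C^{q-1}) + S.                                                         *)
Definition quotient_cohomology (S : forall n, set (precochain n)) (q : nat) :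
    subquotient (precochain q) :=
  Subquotient
    [set g | cochain g /\ S q.+1 (diff g)]
    (match q return set (precochain q) with
     | 0 => S 0%N
     | q'.+1 => [set g | exists2 b, cochain b & S q'.+1 (g - @diff q' b)]
     end).

Definition basicH (q : nat) := quotient_cohomology (fun n => [set 0]) q.

Definition reducedH (q : nat) :=
  quotient_cohomology (fun n => @cochain_partial n @` [set g | cochain g]) q.

End Cohomology.

Section HeisenbergVirasoro.
Variable K : numFieldType.

Lemma poly_ext (p q : {poly K}) : (forall t, p.[t] = q.[t]) -> p = q.
Proof.
move=> pq; apply/eqP; rewrite -subr_eq0; apply/negPn/negP => nz.
have := max_poly_roots nz
  (rs := [seq (i%:R : K) | i <- iota 0 (size (p - q))]).
rewrite size_map size_iota ltnn => H; suff: false by []; apply: H.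
  by apply/allP => x _; rewrite /root !hornerE pq subrr.
by rewrite map_inj_uniq ?iota_uniq // => i j /eqP; rewrite eqr_nat => /eqP.
Qed.

Definition pfam (F : K -> {poly K}) : Prop :=
  exists P : {poly {poly K}}, forall x, F x = P.[x%:P].

Lemma pfam_mul F G : pfam F -> pfam G -> pfam (fun x => F x * G x).
Proof. by move=> [P FP] [Q GQ]; exists (P * Q) => x; rewrite hornerM FP GQ. Qed.

Lemma pfam_add F G : pfam F -> pfam G -> pfam (fun x => F x + G x).
Proof. by move=> [P FP] [Q GQ]; exists (P + Q) => x; rewrite hornerD FP GQ. Qed.

Lemma pfam_cst p : pfam (fun=> p).
Proof. by exists p%:P => x; rewrite hornerC. Qed.

Lemma pfam_polyC : pfam (fun x => x%:P).
Proof. by exists 'X => x; rewrite hornerX. Qed.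

Lemma pfam_scale_horner (f : {poly K}) F :
  pfam F -> pfam (fun x => f.[- x] *: F x).
Proof.
move=> [P FP]; exists (((f \Po (- 'X)) ^:P) * P) => x.
by rewrite hornerM horner_map /= horner_comp !hornerE -FP mul_polyC.
Qed.

Lemma pfam_comp (g : {poly K}) : pfam (fun x => g \Po ('X + x%:P)).
Proof.
exists (g^:P \Po ('X + 'X%:P)) => x.
by rewrite horner_comp !hornerE addrC.
Qed.

Lemma pfamE F : pfam F -> polyfun1 F.
Proof.
move=> [P FP]; exists (size P), (fun k => P`_k) => x.
rewrite FP horner_coef; apply: eq_bigr => k _.
by rewrite -mul_polyC polyC_exp mulrC.
Qed.

Lemma polysum1_widen (V : lmodType K) N N' (c : nat -> V) : (N <= N')%N ->
  polysum1 N c =1 polysum1 N' (fun k => if (k < N)%N then c k else 0).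
Proof.
move=> NN' x; rewrite /polysum1 (big_ord_widen N' (fun k => x ^+ k *: c k)) //.
by rewrite big_mkcond; apply: eq_bigr => k _; case: ifP; rewrite ?scaler0.
Qed.

Lemma polyfun1_pair (V W : lmodType K) (f : K -> V) (g : K -> W) :
  polyfun1 f -> polyfun1 g -> polyfun1 (fun x => (f x, g x) : V * W).
Proof.
move=> [N [c fE]] [M [d gE]]; pose D := maxn N M.
exists D, (fun k => (if (k < N)%N then c k else 0, if (k < M)%N then d k else 0)).
move=> x; rewrite fE gE (polysum1_widen _ (leq_maxl N M)) (polysum1_widen _ (leq_maxr N M)).
rewrite /polysum1 -/D [RHS]surjective_pairing; congr (_, _).
  by rewrite (raddf_sum fst).
by rewrite (raddf_sum snd).
Qed.

(* HV = C[partial] L (+) C[partial] M, with (f, g) standing for               *)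
(* f(partial) L + g(partial) M.  Conformal sesquilinearity forces             *)
(*   [f(partial)u_x g(partial)w] = f(-x) g(partial + x) [u_x w],              *)
(* so that the bracket is determined by its values on L and M.                *)
Definition HVsort : lmodType K := ({poly K} * {poly K})%type.

Definition HVder (a : HVsort) : HVsort := ('X * a.1, 'X * a.2).

Definition sesqui (x : K) (f g bracket : {poly K}) : {poly K} :=
  f.[- x] *: ((g \Po ('X + x%:P)) * bracket).

Definition HVbr (x : K) (a b : HVsort) : HVsort :=
  (sesqui x a.1 b.1 ('X + (x *+ 2)%:P),
   sesqui x a.1 b.2 ('X + x%:P) + sesqui x a.2 b.1 x%:P).

Definition HVL : HVsort := (1, 0).
Definition HVM : HVsort := (0, 1).

Lemma HVbrLL x : HVbr x HVL HVL = HVder HVL + (x *+ 2) *: HVL.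
Proof.
by congr (_, _); apply: poly_ext => t; rewrite /sesqui !(hornerE, horner_comp) /=; ring.
Qed.

Lemma HVbrLM x : HVbr x HVL HVM = HVder HVM + x *: HVM.
Proof.
by congr (_, _); apply: poly_ext => t; rewrite /sesqui !(hornerE, horner_comp) /=; ring.
Qed.

Lemma HVbrML x : HVbr x HVM HVL = x *: HVM.
Proof.
by congr (_, _); apply: poly_ext => t; rewrite /sesqui !(hornerE, horner_comp) /=; ring.
Qed.

Lemma HVbrMM x : HVbr x HVM HVM = 0.
Proof.
by congr (_, _); apply: poly_ext => t; rewrite /sesqui !(hornerE, horner_comp) /=; ring.
Qed.

Lemma HVder_is_linear : linear HVder.
Proof.
by move=> k [a1 a2] [b1 b2]; congr (_, _); apply: poly_ext => t; rewrite !hornerE /=; ring.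
Qed.
HB.instance Definition _ :=
  GRing.isLinear.Build K HVsort HVsort *:%R HVder HVder_is_linear.

Lemma HVbr_poly a b : polyfun1 (fun x => HVbr x a b).
Proof.
have pbr f g (h : K -> {poly K}) : pfam h -> pfam (fun x => sesqui x f g (h x)).
  by move=> hP; apply/pfam_scale_horner/pfam_mul/hP/pfam_comp.
apply: polyfun1_pair; apply: pfamE.
  apply: pbr; apply: pfam_add; first exact: pfam_cst.
  have -> : (fun x : K => (x *+ 2)%:P) = (fun x => x%:P + x%:P).
    by apply/funext => x; rewrite mulr2n polyCD.
  exact: (pfam_add pfam_polyC pfam_polyC).
apply: pfam_add; apply: pbr; last exact: pfam_polyC.
by apply: pfam_add; [exact: pfam_cst | exact: pfam_polyC].
Qed.

Lemma HVbr_linl x k a a' b :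
  HVbr x (k *: a + a') b = k *: HVbr x a b + HVbr x a' b.
Proof.
by congr (_, _); apply: poly_ext => t; rewrite /sesqui !(hornerE, horner_comp) /=; ring.
Qed.

Lemma HVbr_linr x k a b b' :
  HVbr x a (k *: b + b') = k *: HVbr x a b + HVbr x a b'.
Proof.
by congr (_, _); apply: poly_ext => t; rewrite /sesqui !(hornerE, horner_comp) /=; ring.
Qed.

Lemma HVbr_derl x a b : HVbr x (HVder a) b = - (x *: HVbr x a b).
Proof.
by congr (_, _); apply: poly_ext => t; rewrite /sesqui !(hornerE, horner_comp) /=; ring.
Qed.

Lemma HVbr_derr x a b : HVbr x a (HVder b) = HVder (HVbr x a b) + x *: HVbr x a b.
Proof.
by congr (_, _); apply: poly_ext => t; rewrite /sesqui !(hornerE, horner_comp) /=; ring.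
Qed.

Lemma HVbr_jacobi x y a b c :
  HVbr x a (HVbr y b c) = HVbr (x + y) (HVbr x a b) c + HVbr y b (HVbr x a c).
Proof.
have E1 (p : {poly K}) t : p.[t + x + y] = p.[t + y + x] by congr p.[_]; ring.
have E2 (p : {poly K}) t : p.[t + (x + y)] = p.[t + y + x] by congr p.[_]; ring.
have E3 (p : {poly K}) : p.[- (x + y) + x] = p.[- y] by congr p.[_]; ring.
by congr (_, _); apply: poly_ext => t;
  rewrite /sesqui !(hornerE, horner_comp) /= ?E1 ?E2 ?E3; ring.
Qed.

Lemma HVbr_skew a b N (c : nat -> HVsort) :
  (forall y, HVbr y b a = polysum1 N c y) ->
  forall x, HVbr x a b =
    - \sum_(k < N) iter k (fun u => - (x *: u) - HVder u) (c k).
Proof.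
move=> E x.
have it k (u : HVsort) : iter k (fun u => - (x *: u) - HVder u) u
    = ((- x%:P - 'X) ^+ k * u.1, (- x%:P - 'X) ^+ k * u.2).
  elim: k => [|k IHk] /=; first by rewrite !mul1r -surjective_pairing.
  rewrite IHk exprS; congr (_, _); rewrite /= -mul_polyC; ring.
have E1 t : (HVbr (- x - t) b a).1.[t] = \sum_(k < N) (- x - t) ^+ k * (c k).1.[t].
  rewrite E /polysum1 (raddf_sum fst) horner_sum.
  by apply: eq_bigr => k _; rewrite hornerZ.
have E2 t : (HVbr (- x - t) b a).2.[t] = \sum_(k < N) (- x - t) ^+ k * (c k).2.[t].
  rewrite E /polysum1 (raddf_sum snd) horner_sum.
  by apply: eq_bigr => k _; rewrite hornerZ.
have A1 t : - (- x - t) = t + x by ring.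
have A2 t : t - x - t = - x by ring.
rewrite [RHS]surjective_pairing; congr (_, _); apply: poly_ext => t.
  rewrite /= hornerN (raddf_sum fst) horner_sum.
  under eq_bigr => k _ do rewrite it /= hornerM horner_exp !hornerE /=.
  by rewrite -E1 /sesqui /= !(hornerE, horner_comp) /= ?A1 ?A2; ring.
rewrite /= hornerN (raddf_sum snd) horner_sum.
under eq_bigr => k _ do rewrite it /= hornerM horner_exp !hornerE /=.
by rewrite -E2 /sesqui /= !(hornerE, horner_comp) /= ?A1 ?A2; ring.
Qed.

Definition HV : lieConformal K :=
  @LieConformal K HVsort HVder HVbr HVbr_poly HVbr_linl HVbr_linr
    HVbr_derl HVbr_derr HVbr_skew HVbr_jacobi.

(* The one-dimensional module with partial acting as a and HV acting by zero. *)
Section OneDimensional.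
Variable a : K.

Definition Cder (v : K^o) : K^o := a *: v.

Lemma Cder_is_linear : linear Cder.
Proof. by move=> k u v; rewrite /Cder scalerDr !scalerA mulrC. Qed.
HB.instance Definition _ :=
  GRing.isLinear.Build K K^o K^o *:%R Cder Cder_is_linear.

Definition Cact (x : K) (b : HV) (v : K^o) : K^o := 0.

Lemma Cact_poly b v : polyfun1 (fun x => Cact x b v).
Proof. by exists 0%N, (fun=> 0) => x; rewrite /polysum1 big_ord0. Qed.

Lemma Cact_linl x k b b' v :
  Cact x (k *: b + b') v = k *: Cact x b v + Cact x b' v.
Proof. by rewrite /Cact scaler0 addr0. Qed.

Lemma Cact_linr x k b v v' :
  Cact x b (k *: v + v') = k *: Cact x b v + Cact x b v'.
Proof. by rewrite /Cact scaler0 addr0. Qed.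

Lemma Cact_br x y b c v :
  Cact x b (Cact y c v) - Cact y c (Cact x b v) = Cact (x + y) (lca_br x b c) v.
Proof. by rewrite /Cact subr0. Qed.

Lemma Cact_derl x b v : Cact x (lca_der b) v = - (x *: Cact x b v).
Proof. by rewrite /Cact scaler0 oppr0. Qed.

Lemma Cact_derr x b v : Cact x b (Cder v) = Cder (Cact x b v) + x *: Cact x b v.
Proof. by rewrite /Cact /Cder !scaler0 addr0. Qed.

Definition Cmod : lcaModule HV :=
  @LcaModule K HV K^o Cder Cact Cact_poly Cact_linl Cact_linr
    Cact_br Cact_derl Cact_derr.

End OneDimensional.

Definition trivialMod : lcaModule HV := Cmod 0.

(* M_{Delta,alpha} = C[partial]v, with p standing for p(partial)v.            *)
Section RankOne.
Variables Delta alpha : K.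

Definition Mder (p : {poly K}) : {poly K} := 'X * p.

Lemma Mder_is_linear : linear Mder.
Proof. by move=> k u v; rewrite /Mder mulrDr scalerAr. Qed.
HB.instance Definition _ :=
  GRing.isLinear.Build K {poly K} {poly K} *:%R Mder Mder_is_linear.

Definition Mact (x : K) (b : HV) (p : {poly K}) : {poly K} :=
  sesqui x b.1 p ('X + (alpha + Delta * x)%:P).

Lemma MactL x : Mact x HVL 1 = Mder 1 + (alpha + Delta * x) *: 1.
Proof.
by apply: poly_ext => t; rewrite /Mact /Mder /sesqui !(hornerE, horner_comp) /=; ring.
Qed.

Lemma MactM x p : Mact x HVM p = 0.
Proof.
by apply: poly_ext => t; rewrite /Mact /sesqui !(hornerE, horner_comp) /=; ring.
Qed.

Lemma Mact_poly b p : polyfun1 (fun x => Mact x b p).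
Proof.
apply/pfamE/pfam_scale_horner/pfam_mul; first exact: pfam_comp.
apply: pfam_add; first exact: pfam_cst.
have -> : (fun x : K => (alpha + Delta * x)%:P)
    = (fun x => alpha%:P + Delta%:P * x%:P).
  by apply/funext => x; rewrite polyCD polyCM.
by apply: pfam_add; [|apply: pfam_mul; last exact: pfam_polyC]; exact: pfam_cst.
Qed.

Lemma Mact_linl x k b b' v :
  Mact x (k *: b + b') v = k *: Mact x b v + Mact x b' v.
Proof.
by apply: poly_ext => t; rewrite /Mact /sesqui !(hornerE, horner_comp) /=; ring.
Qed.

Lemma Mact_linr x k b v v' :
  Mact x b (k *: v + v') = k *: Mact x b v + Mact x b v'.
Proof.
by apply: poly_ext => t; rewrite /Mact /sesqui !(hornerE, horner_comp) /=; ring.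
Qed.

Lemma Mact_br x y b c v :
  Mact x b (Mact y c v) - Mact y c (Mact x b v) = Mact (x + y) (HVbr x b c) v.
Proof.
have E1 (p : {poly K}) t : p.[t + x + y] = p.[t + y + x] by congr p.[_]; ring.
have E2 (p : {poly K}) t : p.[t + (x + y)] = p.[t + y + x] by congr p.[_]; ring.
have E3 (p : {poly K}) : p.[- (x + y) + x] = p.[- y] by congr p.[_]; ring.
by apply: poly_ext => t;
  rewrite /Mact /sesqui !(hornerE, horner_comp) /= ?E1 ?E2 ?E3; ring.
Qed.

Lemma Mact_derl x b v : Mact x (HVder b) v = - (x *: Mact x b v).
Proof.
by apply: poly_ext => t; rewrite /Mact /sesqui !(hornerE, horner_comp) /=; ring.
Qed.

Lemma Mact_derr x b v : Mact x b (Mder v) = Mder (Mact x b v) + x *: Mact x b v.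
Proof.
by apply: poly_ext => t; rewrite /Mact /Mder /sesqui !(hornerE, horner_comp) /=; ring.
Qed.

Definition Mmod : lcaModule HV :=
  @LcaModule K HV {poly K} Mder Mact Mact_poly Mact_linl Mact_linr
    Mact_br Mact_derl Mact_derr.

End RankOne.

End HeisenbergVirasoro.

(* Main.v *)
Require Import Defs.
From mathcomp Require Import all_boot all_order all_algebra all_fingroup.
From mathcomp Require Import boolp classical_sets functions reals complex ring zify.
Set Implicit Arguments.
Unset Strict Implicit.
Unset Printing Implicit Defensive.
Import Order.TTheory GRing.Theory Num.Theory.
Local Open Scope ring_scope.

(** The proof rests on a Cartan calculus.  For b in A and a value y of the
    indeterminate, let i_(b,y) insert b with indeterminate y as first argument of a
    cochain, and let Lie_(b,y) be the action of the pair (b,y) on cochains.  Cartan's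
    formula i d + d i = Lie ([Cartan]) shows that Lie acts by zero on cohomology.  Since a
    cochain is determined by its contractions, the identities [Lie, Lie] = Lie_[,],
    [Lie, d] = 0 and d d = 0 all follow by induction on the degree
    ([Lie_br], [Lie_diff], [diff_diff]).

    Evaluating Cartan's formula for L at y = 0: as [L_0 a] = der a for all a, and as
    L_0 acts by der + c on the two families of modules (c = - a, resp. c = alpha), the
    operator Lie_(L,0) is partial + c.  In the reduced complex partial is zero, so the
    scalar c is homotopic to zero and the cohomology vanishes when c is nonzero
    ([reducedH_vanish]).

    For the trivial module c = 0, and the same homotopy shows that partial acts by
    zero on basic cohomology.  As partial is injective in positive degree, the long
    exact sequence of the quotient complex splits into short ones and the reduced
    cohomology in degree q > 0 is the sum of the basic cohomologies in degrees q and q+1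
    ([reduced_of_basic]).

    It remains to find the basic cohomology of the trivial module.  A cochain is a
    combination of exterior products of the coordinate functionals L_m, M_m sending
    f(der) L + h(der) M to f(-x) x^m and h(-x) x^m ([cochain_combinationP]).  The
    coefficient of y in Lie_(L,y) is an Euler operator, diagonal on exterior products,
    for which L_m has weight m - 1 and M_m has weight m ([euler_wedge]); being
    homotopic to zero, it reduces everything to weight zero ([weight_zero_part]).  Only
    L_0 has negative weight, so a weightless product is a product of a subset of
    {L_1, M_0}, possibly multiplied by L_0 L_2 or L_0 M_1.  This leaves a complex of
    dimensions 1, 2, 3, 4, 2, in which d L_1 = L_0 L_2, d M_0 = L_0 M_1,
    d (L_1 M_0) = L_0 L_2 M_0 - L_0 M_1 L_1 and every other differential is zero. *)

(** * Polynomial functions *)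
Section PolyfunClosure.
Variables (K : numFieldType) (V : lmodType K).

Lemma polyfun_ext n (f g : ('I_n -> K) -> V) : f =1 g -> polyfun f -> polyfun g.
Proof. by move=> fg [N [c fE]]; exists N, c => x; rewrite -fg. Qed.

Lemma polyfun0 n : polyfun (fun _ : 'I_n -> K => 0 : V).
Proof.
by exists 1%N, (fun=> 0) => x; rewrite /polysum big1 // => m _; rewrite scaler0.
Qed.

Lemma polyfun_scale n k (f : ('I_n -> K) -> V) :
  polyfun f -> polyfun (fun x => k *: f x).
Proof.
move=> [N [c fE]]; exists N, (fun m => k *: c m) => x; rewrite fE /polysum scaler_sumr.
by apply: eq_bigr => m _; rewrite !scalerA mulrC.
Qed.

Lemma polyfun_widen n N N' (c : {ffun 'I_n -> 'I_N} -> V) : (N <= N')%N ->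
  exists c' : {ffun 'I_n -> 'I_N'} -> V, polysum c =1 polysum c'.
Proof.
move=> NN'; pose w (m : {ffun 'I_n -> 'I_N}) := [ffun i => widen_ord NN' (m i)].
exists (fun m' => \sum_(m | w m == m') c m) => x; rewrite /polysum.
rewrite (partition_big w xpredT) //=; apply: eq_bigr => m' _.
rewrite scaler_sumr; apply: eq_bigr => m /eqP <-; congr (_ *: _).
by apply: eq_bigr => i _; rewrite ffunE.
Qed.

Lemma polyfunD n (f g : ('I_n -> K) -> V) :
  polyfun f -> polyfun g -> polyfun (fun x => f x + g x).
Proof.
move=> [N [c fE]] [M [d gE]].
have [c' cE] := polyfun_widen c (leq_maxl N M).
have [d' dE] := polyfun_widen d (leq_maxr N M).
exists (maxn N M), (fun m => c' m + d' m) => x; rewrite fE gE cE dE /polysum -big_split.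
by apply: eq_bigr => m _; rewrite scalerDr.
Qed.

Lemma polyfun_sum n (I : Type) (r : seq I) (P : pred I) (F : I -> ('I_n -> K) -> V) :
  (forall i, P i -> polyfun (F i)) -> polyfun (fun x => \sum_(i <- r | P i) F i x).
Proof.
move=> pF; elim: r => [|i r IHr].
  by apply: polyfun_ext (polyfun0 n) => x; rewrite big_nil.
case Pi: (P i); last by apply: polyfun_ext IHr => x; rewrite big_cons Pi.
by apply: polyfun_ext (polyfunD (pF i Pi) IHr) => x; rewrite big_cons Pi.
Qed.

Lemma polyfun_prod n (p : 'I_n -> {poly K}) (v : V) :
  polyfun (fun x => (\prod_i (p i).[x i]) *: v).
Proof.
pose N := \max_i size (p i).
exists N, (fun m : {ffun 'I_n -> 'I_N} => (\prod_i (p i)`_(m i)) *: v) => x; rewrite /polysum.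
have E i : (p i).[x i] = \sum_(k < N) (p i)`_k * x i ^+ k.
  by apply: horner_coef_wide; apply: leq_bigmax.
under eq_bigr => i _ do rewrite E.
rewrite bigA_distr_bigA /= scaler_suml; apply: eq_bigr => m _.
by rewrite scalerA big_split /= mulrC.
Qed.

Lemma polyfun_scaleM n (p : ('I_n -> K) -> K^o) (f : ('I_n -> K) -> V) :
  polyfun p -> polyfun f -> polyfun (fun x => p x *: f x).
Proof.
move=> [N [c pE]] [M [d fE]].
pose F (u : {ffun 'I_n -> 'I_N} * {ffun 'I_n -> 'I_M}) i : {poly K} := 'X^(u.1 i + u.2 i).
have: polyfun (fun x : 'I_n -> K => \sum_u (\prod_i (F u i).[x i]) *: (c u.1 *: d u.2)).
  by apply: polyfun_sum => u _; apply: polyfun_prod.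
apply: polyfun_ext => x; rewrite pE fE scaler_suml.
under [RHS]eq_bigr => m _ do rewrite scaler_sumr.
rewrite pair_bigA; apply: eq_bigr => -[m l] _ /=; rewrite !scalerA; congr (_ *: _).
have -> : \prod_i (F (m, l) i).[x i] = (\prod_i x i ^+ m i) * \prod_i x i ^+ l i.
  by rewrite -big_split; apply: eq_bigr => i _; rewrite hornerXn exprD.
by rewrite mulrAC.
Qed.

Lemma polyfun_cst n (v : V) : polyfun (fun _ : 'I_n -> K => v).
Proof.
apply: polyfun_ext (polyfun_prod (fun=> 1) v) => x.
by rewrite big1 ?scale1r // => i _; rewrite hornerC.
Qed.

End PolyfunClosure.

Section ScalarPolyfun.
Variable K : numFieldType.

Lemma polyfun_coord n (i : 'I_n) : polyfun (fun x => x i : K^o).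
Proof.
apply: polyfun_ext (polyfun_prod (fun j => if j == i then 'X else 1) (1 : K^o)) => x.
rewrite (bigD1 i) //= eqxx hornerX big1 => [|j /negbTE ->]; last by rewrite hornerC.
by rewrite mulr1 [LHS]mulr1.
Qed.

Lemma polyfun_exp n (p : ('I_n -> K) -> K^o) k : polyfun p -> polyfun (fun x => p x ^+ k : K^o).
Proof.
move=> pp; elim: k => [|k IHk]; first exact: polyfun_cst.
by apply: polyfun_ext (polyfun_scaleM pp IHk) => x; rewrite exprS.
Qed.

Lemma polyfun_bigprod n (I : Type) (r : seq I) (P : pred I) (F : I -> ('I_n -> K) -> K^o) :
  (forall i, polyfun (F i)) -> polyfun (fun x => \prod_(i <- r | P i) F i x : K^o).
Proof.
move=> pF; elim: r => [|i r IHr].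
  by apply: polyfun_ext (polyfun_cst _ 1) => x; rewrite big_nil.
case Pi: (P i); last by apply: polyfun_ext IHr => x; rewrite big_cons Pi.
by apply: polyfun_ext (polyfun_scaleM (pF i) IHr) => x; rewrite big_cons Pi.
Qed.

Lemma polyfun_comp (V : lmodType K) n m (f : ('I_m -> K) -> V)
    (h : 'I_m -> ('I_n -> K) -> K^o) :
  polyfun f -> (forall i, polyfun (h i)) -> polyfun (fun x => f (fun i => h i x)).
Proof.
move=> [N [c fE]] hP; apply: (@polyfun_ext _ _ _ (fun x => polysum c (fun i => h i x))).
  by move=> x; rewrite fE.
apply: polyfun_sum => u _; apply: polyfun_scaleM (polyfun_cst _ _).
by apply: polyfun_bigprod => i; apply: polyfun_exp.
Qed.

End ScalarPolyfun.

(** * Contractions of cochains *)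
Section Contraction.
Variables (K : numFieldType) (A : lieConformal K) (V : lcaModule A).
Implicit Types (n : nat) (b : A) (y : K).

Definition upd T n (a : 'I_n -> T) (j : 'I_n) (u : T) : 'I_n -> T :=
  fun i => if i == j then u else a i.

Lemma etaE T n (a : 'I_n -> T) (j : 'I_n) (u : T) : [eta a with j |-> u] = upd a j u :> (_ -> _).
Proof. by []. Qed.

Lemma fcons0 T n (t : T) (a : 'I_n -> T) : fcons t a ord0 = t.
Proof. by rewrite /fcons unlift_none. Qed.

Lemma fconsS T n (t : T) (a : 'I_n -> T) j : fcons t a (lift ord0 j) = a j.
Proof. by rewrite /fcons liftK. Qed.

Lemma ord_funP T n (f g : 'I_n.+1 -> T) : f ord0 = g ord0 ->
  (forall j, f (lift ord0 j) = g (lift ord0 j)) -> f = g.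
Proof.
by move=> E0 ES; apply/funext => i; case: (unliftP ord0 i) => [j ->|->].
Qed.

Lemma fcons_lift0 T n (t : T) (a : 'I_n -> T) : fcons t a \o lift ord0 = a.
Proof. by apply/funext => j; rewrite /= fconsS. Qed.

Lemma fcons_eta T n (a : 'I_n.+1 -> T) : fcons (a ord0) (a \o lift ord0) = a.
Proof. by apply: ord_funP => [|j]; rewrite ?fcons0 ?fconsS. Qed.

Lemma lift0_lift n (i : 'I_n.+1) (k : 'I_n) :
  lift (lift ord0 i) (lift ord0 k) = lift ord0 (lift i k).
Proof. by apply: val_inj; rewrite /= /bump /= !add1n ltnS addnS. Qed.

Lemma lift0_0 n (i : 'I_n.+1) : lift (lift ord0 i) ord0 = ord0.
Proof. by apply: val_inj. Qed.

Lemma fcons_lift T n (t : T) (a : 'I_n.+1 -> T) i :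
  fcons t a \o lift (lift ord0 i) = fcons t (a \o lift i).
Proof.
by apply: ord_funP => [|j] /=; rewrite ?lift0_0 ?lift0_lift !(fcons0, fconsS).
Qed.

Lemma upd_fcons0 T n (t u : T) (a : 'I_n -> T) : upd (fcons t a) ord0 u = fcons u a.
Proof. by apply: ord_funP => [|j]; rewrite /upd /= !(fcons0, fconsS). Qed.

Lemma upd_fconsS T n (t u : T) (a : 'I_n -> T) j :
  upd (fcons t a) (lift ord0 j) u = fcons t (upd a j u).
Proof.
apply: ord_funP => [|k]; first by rewrite /upd !fcons0.
by rewrite /upd !fconsS (inj_eq lift_inj).
Qed.

Definition contract n b y (g : precochain V n.+1) : precochain V n :=
  fun a x => g (fcons b a) (fcons y x).

Lemma precochainP n (f g : precochain V n) : (forall a x, f a x = g a x) -> f = g.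
Proof. by move=> fg; apply/funext => a; apply/funext => x. Qed.

(** Contractions separate cochains of positive degree: this is what makes induction on
    the degree work for identities between operators. *)
Lemma contract_inj n (f g : precochain V n.+1) :
  (forall b y, contract b y f = contract b y g) -> f = g.
Proof.
move=> fg; apply: precochainP => a x.
rewrite -(fcons_eta a) -(fcons_eta x).
exact: (congr1 (fun h : precochain V n => h _ _) (fg _ _)).
Qed.

Lemma precochainD n (f g : precochain V n) a x : (f + g) a x = f a x + g a x.
Proof. by []. Qed.

Lemma precochainZ n k (f : precochain V n) a x : (k *: f) a x = k *: f a x.
Proof. by []. Qed.

Lemma precochainN n (f : precochain V n) a x : (- f) a x = - f a x.
Proof. by []. Qed.

Lemma precochain_sum n (I : Type) (r : seq I) (P : pred I) (F : I -> precochain V n) a x :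
  (\sum_(i <- r | P i) F i) a x = \sum_(i <- r | P i) F i a x.
Proof. by rewrite !fct_sumE. Qed.

Definition precochainE := (precochainD, precochainZ, precochainN, precochain_sum).

Lemma cochain0 n : cochain (0 : precochain V n).
Proof.
split=> [a|i k u v a x|i a x|s a x]; rewrite /GRing.zero /= ?scaler0 ?addr0 ?oppr0 //.
exact: polyfun0.
Qed.

Lemma cochainD n (f g : precochain V n) : cochain f -> cochain g -> cochain (f + g).
Proof.
move=> [fp fl fd fs] [gp gl gd gs].
split=> [a|i k u v a x|i a x|s a x]; rewrite ?precochainE.
- exact: polyfunD (fp a) (gp a).
- by rewrite fl gl !scalerDr addrACA.
- by rewrite fd gd !scalerDr opprD.
- by rewrite fs gs scalerDr.
Qed.

Lemma cochainZ n k (g : precochain V n) : cochain g -> cochain (k *: g).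
Proof.
move=> [gp gl gd gs]; split=> [a|i k' u v a x|i a x|s a x]; rewrite ?precochainE.
- exact: polyfun_scale (gp a).
- by rewrite gl !scalerDr !scalerA mulrC.
- by rewrite gd !scalerN !scalerA mulrC.
- by rewrite gs !scalerA mulrC.
Qed.

Lemma cochainB n (f g : precochain V n) : cochain f -> cochain g -> cochain (f - g).
Proof. by move=> cf cg; rewrite -scaleN1r; apply/cochainD/cochainZ. Qed.

Lemma cochain_sum n (I : Type) (r : seq I) (P : pred I) (F : I -> precochain V n) :
  (forall i, P i -> cochain (F i)) -> cochain (\sum_(i <- r | P i) F i).
Proof. by move=> cF; elim/big_ind: _ => //; [exact: cochain0 | exact: cochainD]. Qed.

Lemma cochain_contract n b y (g : precochain V n.+1) : cochain g -> cochain (contract b y g).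
Proof.
move=> [gp gl gd gs]; split=> [a|i k u v a x|i a x|s a x]; rewrite /contract.
- have [N [c gE]] := gp (fcons b a).
  pose p (m : {ffun 'I_n.+1 -> 'I_N}) i : {poly K} := 'X^(m (lift ord0 i)).
  have: polyfun (fun x : 'I_n -> K => \sum_(m : {ffun 'I_n.+1 -> 'I_N})
      (\prod_i (p m i).[x i]) *: (y ^+ m ord0 *: c m)).
    by apply: polyfun_sum => m _; apply: polyfun_prod.
  apply: polyfun_ext => x; rewrite gE; apply: eq_bigr => m _.
  rewrite scalerA mulrC big_ord_recl fcons0; congr (_ * _ *: _).
  by apply: eq_bigr => i _; rewrite fconsS hornerXn.
- have E w : fcons b (upd a i w) = upd (fcons b a) (lift ord0 i) w.
    by rewrite upd_fconsS.
  by rewrite !E; apply: gl.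
- have E w : fcons b (upd a i w) = upd (fcons b a) (lift ord0 i) w.
    by rewrite upd_fconsS.
  by rewrite E; have := gd (lift ord0 i) (fcons b a) (fcons y x); rewrite !fconsS.
- have E T (t : T) (c : 'I_n -> T) :
      fcons t (c \o s) = fcons t c \o lift_perm ord0 ord0 s.
    by apply: ord_funP => [|j] /=; rewrite ?lift_perm_id ?lift_perm_lift !(fcons0, fconsS).
  by rewrite !E gs odd_lift_perm.
Qed.

End Contraction.

(** * Cartan calculus *)
Section CartanCalculus.
Variables (K : numFieldType) (A : lieConformal K) (V : lcaModule A).
Implicit Types (n : nat) (b c : A) (y z : K).

(** Skew-symmetry in terms of contractions only: the first two arguments anticommute,
    and so on recursively for the contractions.  Unlike the formulation with
    permutations, it can be checked on d g by Cartan's formula and induction;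
    [alternating_skew] recovers all permutations. *)
Definition swap01 n (g : precochain V n.+2) : Prop :=
  forall b y c z, contract c z (contract b y g) = - contract b y (contract c z g).

Fixpoint alternating n : precochain V n -> Prop :=
  match n with
  | 0 => fun=> True
  | n'.+1 => fun g =>
      match n' return precochain V n'.+1 -> Prop with
      | 0 => fun=> True
      | n''.+1 => @swap01 n''
      end g /\ forall b y, alternating (contract b y g)
  end.

Lemma contractD n b y (f g : precochain V n.+1) :
  contract b y (f + g) = contract b y f + contract b y g.
Proof. by []. Qed.

Lemma contractN n b y (g : precochain V n.+1) : contract b y (- g) = - contract b y g.
Proof. by []. Qed.

Lemma contractZ n b y k (g : precochain V n.+1) : contract b y (k *: g) = k *: contract b y g.
Proof. by []. Qed.

Lemma contract0 n b y : contract b y (0 : precochain V n.+1) = 0.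
Proof. by []. Qed.

Lemma contract_sumr n b y (I : Type) (r : seq I) (P : pred I) (F : I -> precochain V n.+1) :
  contract b y (\sum_(i <- r | P i) F i) = \sum_(i <- r | P i) contract b y (F i).
Proof. exact: (big_morph (contract b y) (contractD b y) (erefl _)). Qed.

Lemma alternatingD n (f g : precochain V n) :
  alternating f -> alternating g -> alternating (f + g).
Proof.
elim: n f g => [//|n IHn] f g [sf af] [sg ag]; split; last first.
  by move=> b y; rewrite contractD; apply: IHn; [apply: af|apply: ag].
case: n {IHn} f g sf sg {af ag} => [//|n] f g sf sg b y c z.
by rewrite !contractD sf sg opprD.
Qed.

Lemma alternatingZ n k (g : precochain V n) : alternating g -> alternating (k *: g).
Proof.
elim: n g => [//|n IHn] g [sg ag]; split; last first.
  by move=> b y; rewrite contractZ; apply: IHn; apply: ag.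
case: n {IHn} g sg {ag} => [//|n] g sg b y c z.
by rewrite !contractZ sg scalerN.
Qed.

Lemma alternatingN n (g : precochain V n) : alternating g -> alternating (- g).
Proof. by rewrite -scaleN1r; apply: alternatingZ. Qed.

Lemma alternatingB n (f g : precochain V n) :
  alternating f -> alternating g -> alternating (f - g).
Proof. by move=> af ag; apply/alternatingD/alternatingN. Qed.

Lemma cochain_alternating n (g : precochain V n) : cochain g -> alternating g.
Proof.
elim: n g => [//|n IHn] g cg; split; last by move=> b y; exact/IHn/cochain_contract.
case: n {IHn} g cg => [//|n] g [_ _ _ gs] b y c z; apply: precochainP => a x.
rewrite /contract precochainN.
have E T (t u : T) d : fcons u (fcons t d) = 
      fcons t (fcons u d) \o tperm ord0 (lift ord0 (ord0 : 'I_n.+1)).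
  apply: ord_funP => [|j]; first by rewrite /= tpermL fconsS !fcons0.
  case: (unliftP ord0 j) => [i ->|->]; last by rewrite /= tpermR fconsS !fcons0.
  by rewrite /= tpermD ?fconsS.
by rewrite /contract E [X in g _ X]E gs odd_tperm /= expr1 scaleN1r.
Qed.

(** The cyclic shift of the first j+1 arguments has sign (-1)^j. *)
Lemma alternating_move n (g : precochain V n.+1) (j : 'I_n.+1) b y a x : alternating g ->
  g (fcons b (a \o lift j)) (fcons y (x \o lift j))
    = (-1) ^+ j *: g (upd a j b) (upd x j y).
Proof.
have E0 T (t : T) m (c : 'I_m.+1 -> T) : upd c ord0 t = fcons t (c \o lift ord0).
  by rewrite -{1}(fcons_eta c) upd_fcons0.
elim: n g j b y a x => [|n IHn] g j b y a x ag.
  by rewrite (ord1 j) expr0 scale1r !E0.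
case: (unliftP ord0 j) => [i ->|->]; last by rewrite expr0 scale1r !E0.
have [sg aig] := ag.
rewrite -(fcons_eta a) -(fcons_eta x); move: (a ord0) (x ord0) (a \o _) (x \o _).
move=> c z a' x'; rewrite !fcons_lift !upd_fconsS.
have := congr1 (fun h : precochain V n => h (a' \o lift i) (x' \o lift i)) (sg b y c z).
rewrite precochainN /contract => ->.
have := IHn _ i b y a' x' (aig c z); rewrite /contract => ->.
by rewrite -scaleN1r scalerA -exprS.
Qed.

(** Locked, so that rewriting with the laws of addition does not unfold it. *)
Definition Lie n b y (g : precochain V n) : precochain V n := locked (fun a x =>
  lcm_act y b (g a x) - \sum_j g (upd a j (lca_br y b (a j))) (upd x j (y + x j))).

Lemma LieE n b y (g : precochain V n) a x : Lie b y g a x =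
  lcm_act y b (g a x) - \sum_j g (upd a j (lca_br y b (a j))) (upd x j (y + x j)).
Proof. by rewrite /Lie -lock. Qed.

Lemma actDr (x : K) b (v w : V) : lcm_act x b (v + w) = lcm_act x b v + lcm_act x b w.
Proof. by rewrite -{1}(scale1r v) lcm_act_linr scale1r. Qed.

Lemma act0r (x : K) b : lcm_act x b (0 : V) = 0.
Proof. by apply: (addrI (lcm_act x b (0 : V))); rewrite -actDr !addr0. Qed.

Lemma actZr (x : K) b k (v : V) : lcm_act x b (k *: v) = k *: lcm_act x b v.
Proof. by rewrite -{1}(addr0 (k *: v)) lcm_act_linr act0r addr0. Qed.

Lemma act_sumr (x : K) b (I : Type) (r : seq I) (P : pred I) (F : I -> V) :
  lcm_act x b (\sum_(i <- r | P i) F i) = \sum_(i <- r | P i) lcm_act x b (F i).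
Proof. exact: (big_morph _ (actDr x b) (act0r x b)). Qed.

Lemma sign_lift n (i : 'I_n) : (-1) ^+ (lift ord0 i) = - (-1) ^+ i :> K.
Proof. by rewrite /= /bump /= add1n exprS mulN1r. Qed.

Lemma contract_diff_act n b y (g : precochain V n.+1) a x :
  contract b y (diff_act g) a x = lcm_act y b (g a x) - diff_act (contract b y g) a x.
Proof.
rewrite /contract /diff_act big_ord_recl /= expr0 scale1r !fcons0 !fcons_lift0 -sumrN.
congr (_ + _); apply: eq_bigr => i _.
by rewrite !fcons_lift !fconsS sign_lift scaleNr.
Qed.

Lemma contract_diff_act0 b y (g : precochain V 0) a x :
  contract b y (diff_act g) a x = lcm_act y b (g a x).
Proof.
by rewrite /contract /diff_act big_ord1 expr0 scale1r !fcons0 !fcons_lift0.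
Qed.

Lemma Lie0E b y (g : precochain V 0) a x : Lie b y g a x = lcm_act y b (g a x).
Proof. by rewrite LieE big_ord0 subr0. Qed.

(** The terms of the differential in which the bracket involves the first argument make
    up the non-constant part of the Lie derivative. *)
Lemma diff_br_first n b y (g : precochain V n.+1) a x : alternating g ->
  \sum_(j < n.+1) (-1) ^+ (lift ord0 j) *:
     g (fcons (lca_br y b (a j)) (a \o lift j)) (fcons (y + x j) (x \o lift j))
  = - \sum_j g (upd a j (lca_br y b (a j))) (upd x j (y + x j)).
Proof.
move=> ag; rewrite -sumrN; apply: eq_bigr => j _.
rewrite alternating_move // sign_lift scalerA mulNr -expr2 sqrr_sign.
by rewrite scaleN1r.
Qed.

Theorem Cartan0 b y (g : precochain V 0) : contract b y (diff g) = Lie b y g.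
Proof. by apply: precochainP => a x; rewrite contract_diff_act0 Lie0E. Qed.

(** Cartan's formula.  Terms of d g not involving the inserted first argument b are those
    of - d (i g): the index of each remaining argument is shifted by one, and in the
    bracket terms b and the bracket trade places, which costs one more sign. *)
Theorem Cartan n b y (g : precochain V n.+1) : alternating g ->
  contract b y (diff g) = Lie b y g - diff (contract b y g).
Proof.
move=> ag; apply: precochainP => a x.
rewrite /= contractD !precochainE contract_diff_act.
rewrite [X in _ + X = _]/contract [X in _ + X = _]/diff_br big_ord_recl.
have -> : \sum_(j' < n.+1 | (@ord0 n.+1 <= j')%N) (let j := lift ord0 j' in
    (-1) ^+ (@ord0 n.+1 + j) *: g (fcons (lca_br (fcons y x ord0) (fcons b a ord0) (fcons b a j))
      (fcons b a \o lift ord0 \o lift j'))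
      (fcons (fcons y x ord0 + fcons y x j) (fcons y x \o lift ord0 \o lift j')))
   = - \sum_j g (upd a j (lca_br y b (a j))) (upd x j (y + x j)).
  rewrite -diff_br_first //; apply: eq_big => [j'|j' _]; first by rewrite leq0n.
  by rewrite /= !fcons0 !fconsS add0n !fcons_lift0.
rewrite LieE; case: n g ag a x => [|n] g ag a x.
  rewrite [X in _ + (_ + X)]big1 ?addr0 => [|i _]; last first.
    by rewrite big_pred0 // => j'; rewrite (ord1 i) (ord1 j').
  by rewrite addrAC.
rewrite [X in _ = _ - _ - X]/= !precochainE.
set T := (X in _ + (_ + X) = _).
have -> : T = - diff_br (contract b y g) a x; last by rewrite opprD addrACA.
rewrite /T /diff_br -sumrN; apply: eq_bigr => i _.
rewrite big_mkcond big_ord_recl /=.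
rewrite add0r -big_mkcond /= -sumrN; apply: eq_big => [j'|j' _].
  by rewrite /bump /= !add1n ltnS.
rewrite lift0_lift !fconsS !fcons_lift.
have [sg _] := ag.
have := congr1 (fun h : precochain V n => h (a \o lift i \o lift j') (x \o lift i \o lift j'))
  (sg b y (lca_br (x i) (a i) (a (lift i j'))) (x i + x (lift i j'))).
rewrite precochainN /contract => E.
rewrite /= E scalerN opprK.
have -> : (bump 0 i + bump (bump 0 i) (bump 0 j') = (i + bump i j').+2)%N.
  by rewrite /bump !add1n ltnS addSn !addnS.
by rewrite !exprS !mulN1r opprK.
Qed.

Lemma diffD n (f g : precochain V n) : diff (f + g) = diff f + diff g.
Proof.
have actD m (f' g' : precochain V m) : diff_act (f' + g') = diff_act f' + diff_act g'.
  apply: precochainP => a x; rewrite precochainD /diff_act -big_split /=.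
  by apply: eq_bigr => i _; rewrite precochainD actDr scalerDr.
case: n f g => [|n] f g; rewrite /= actD // addrACA; congr (_ + _).
apply: precochainP => a x; rewrite precochainD /diff_br -big_split /=.
apply: eq_bigr => i _; rewrite -big_split /=.
by apply: eq_bigr => j _; rewrite precochainD scalerDr.
Qed.

Lemma diffZ n k (g : precochain V n) : diff (k *: g) = k *: diff g.
Proof.
have actZ m (g' : precochain V m) : diff_act (k *: g') = k *: diff_act g'.
  apply: precochainP => a x; rewrite precochainZ /diff_act scaler_sumr.
  by apply: eq_bigr => i _; rewrite precochainZ actZr !scalerA mulrC.
case: n g => [|n] g; rewrite /= actZ // scalerDr; congr (_ + _).
apply: precochainP => a x; rewrite precochainZ /diff_br scaler_sumr.
apply: eq_bigr => i _; rewrite scaler_sumr.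
by apply: eq_bigr => j _; rewrite precochainZ !scalerA mulrC.
Qed.

Lemma diffN n (g : precochain V n) : diff (- g) = - diff g.
Proof. by rewrite -scaleN1r diffZ scaleN1r. Qed.

Lemma diffB n (f g : precochain V n) : diff (f - g) = diff f - diff g.
Proof. by rewrite diffD diffN. Qed.

Lemma diff0 n : diff (0 : precochain V n) = 0.
Proof. by rewrite -(scale0r (0 : precochain V n)) diffZ scale0r. Qed.

Lemma diff_sum n (I : Type) (r : seq I) (P : pred I) (F : I -> precochain V n) :
  diff (\sum_(i <- r | P i) F i) = \sum_(i <- r | P i) diff (F i).
Proof. exact: (big_morph _ (@diffD n) (@diff0 n)). Qed.

Lemma LieD n b y (f g : precochain V n) : Lie b y (f + g) = Lie b y f + Lie b y g.
Proof.
apply: precochainP => a x; rewrite precochainD !LieE precochainD actDr.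
under eq_bigr => j _ do rewrite precochainD.
by rewrite big_split opprD addrACA.
Qed.

Lemma LieZ n b y k (g : precochain V n) : Lie b y (k *: g) = k *: Lie b y g.
Proof.
apply: precochainP => a x; rewrite precochainZ !LieE precochainZ actZr scalerBr scaler_sumr.
by [].
Qed.

Lemma LieN n b y (g : precochain V n) : Lie b y (- g) = - Lie b y g.
Proof. by rewrite -scaleN1r LieZ scaleN1r. Qed.

Lemma LieB n b y (f g : precochain V n) : Lie b y (f - g) = Lie b y f - Lie b y g.
Proof. by rewrite LieD LieN. Qed.

Lemma contract_Lie n b y c z (g : precochain V n.+1) :
  contract c z (Lie b y g) = Lie b y (contract c z g) - contract (lca_br y b c) (y + z) g.
Proof.
apply: precochainP => a x; rewrite !precochainE /contract !LieE big_ord_recl.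
rewrite !upd_fcons0 !fcons0 opprD addrA addrAC; congr (_ - _ - _).
by apply: eq_bigr => j _; rewrite !fconsS !upd_fconsS.
Qed.

(** Cochains stripped of polynomiality, with skew-symmetry in recursive form. *)
Record sesquiform n (g : precochain V n) : Prop := Sesquiform {
  form_linear : forall (i : 'I_n) (k : K) (u v : A) a x,
    g (upd a i (k *: u + v)) x = k *: g (upd a i u) x + g (upd a i v) x;
  form_der : forall (i : 'I_n) a x, g (upd a i (lca_der (a i))) x = - (x i *: g a x);
  form_alternating : alternating g
}.

Lemma cochain_form n (g : precochain V n) : cochain g -> sesquiform g.
Proof.
move=> cg; have [_ gl gd _] := cg.
by split; [exact: gl | exact: gd | exact: cochain_alternating].
Qed.

Lemma form_contract n b y (g : precochain V n.+1) :
  sesquiform g -> sesquiform (contract b y g).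
Proof.
move=> [gl gd ga]; split=> [i k u v a x|i a x|]; last by have [_] := ga; apply.
  by rewrite /contract -!upd_fconsS gl.
rewrite /contract -upd_fconsS -{1}(fconsS b a i) gd.
by rewrite fconsS.
Qed.

Section Form.
Variables (n : nat) (g : precochain V n.+1).
Hypothesis gP : sesquiform g.

Lemma contract_linear k b c y :
  contract (k *: b + c) y g = k *: contract b y g + contract c y g.
Proof.
apply: precochainP => a x; rewrite !precochainE /contract.
have := form_linear gP ord0 k b c (fcons b a) (fcons y x).
by rewrite !upd_fcons0.
Qed.

Lemma contract_der b y : contract (lca_der b) y g = - (y *: contract b y g).
Proof.
apply: precochainP => a x; rewrite !precochainE /contract.
have := form_der gP ord0 (fcons b a) (fcons y x).
by rewrite fcons0 upd_fcons0 fcons0.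
Qed.

Lemma contractDl b c y : contract (b + c) y g = contract b y g + contract c y g.
Proof. by rewrite -{1}(scale1r b) contract_linear scale1r. Qed.

Lemma contract0l y : contract 0 y g = 0.
Proof. by apply: (addrI (contract 0 y g)); rewrite -contractDl !addr0. Qed.

Lemma contractZl k b y : contract (k *: b) y g = k *: contract b y g.
Proof. by rewrite -(addr0 (k *: b)) contract_linear contract0l addr0. Qed.

Lemma contractNl b y : contract (- b) y g = - contract b y g.
Proof. by rewrite -scaleN1r contractZl scaleN1r. Qed.

Lemma contract_suml (I : Type) (r : seq I) (P : pred I) (F : I -> A) y :
  contract (\sum_(i <- r | P i) F i) y g = \sum_(i <- r | P i) contract (F i) y g.
Proof.
exact: (big_morph (fun b => contract b y g) (fun b c => contractDl b c y) (contract0l y)).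
Qed.

(** Inside a sesquilinear functional with first indeterminate y + z, the operator
    - y - der becomes multiplication by z, so skew-symmetry of the bracket takes the
    naive form. *)
Lemma contract_br_skew b c y z :
  contract (lca_br y b c) (y + z) g = - contract (lca_br z c b) (z + y) g.
Proof.
have [N [d dE]] := lca_br_poly c b.
rewrite (lca_br_skew dE) contractNl contract_suml dE /polysum1 contract_suml [z + y]addrC.
congr (- _); apply: eq_bigr => k _; rewrite contractZl.
elim: {k}(k : nat) (d k) => [|k IHk] u /=; first by rewrite scale1r.
rewrite contractDl !contractNl contractZl contract_der IHk opprK [X in X = _]addrC -scalerBl.
by rewrite [y + z - y]addrAC subrr add0r exprS scalerA.
Qed.

End Form.

(** By induction on the degree: contracting reduces the claim to degree 0, where it is an
    axiom of modules, and to the Jacobi identity. *)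
Theorem Lie_br n b y c z (g : precochain V n) : sesquiform g ->
  Lie b y (Lie c z g) - Lie c z (Lie b y g) = Lie (lca_br y b c) (y + z) g.
Proof.
elim: n g => [|n IHn] g gP.
  by apply: precochainP => a x; rewrite !precochainE !Lie0E lcm_act_br.
apply: contract_inj => d w; rewrite contractD contractN !contract_Lie.
rewrite !(LieB _ _ (Lie _ _ _)) -(IHn _ (form_contract _ _ gP)).
rewrite (lca_br_jacobi y z b c d) (contractDl gP) !opprB opprD !addrA [z + y]addrC.
by rewrite [LHS](ACl (1*9*6*(5*2)*(3*7)*(8*4))) /= !subrr !addr0.
Qed.

Lemma alternating_Lie n b y (g : precochain V n) : alternating g -> alternating (Lie b y g).
Proof.
elim: n g => [//|n IHn] g ag; have [sg aig] := ag; split; last first.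
  move=> c z; rewrite contract_Lie; apply: alternatingB; [apply: IHn|]; exact: aig.
case: n {IHn} g sg {ag} aig => [//|n] g sg aig c z d w.
rewrite !contract_Lie !contractD !contractN !contract_Lie sg -scaleN1r LieZ scaleN1r.
rewrite (sg (lca_br y b c)) (sg c _ (lca_br y b d)) !opprD !opprK -!addrA.
by congr (_ + _); rewrite addrC.
Qed.

(** Contracting d g twice gives, by Cartan's formula,
    Lie_b i_c - i_[b,c] - Lie_c i_b + d i_c i_b, which is skew in b and c. *)
Theorem alternating_diff n (g : precochain V n) : sesquiform g -> alternating (diff g).
Proof.
elim: n g => [|n IHn] g gP; first by split.
have [_ _ ag] := gP; have aig b y : alternating (contract b y g).
  exact: form_alternating (form_contract b y gP).
split; last first.
  move=> b y; rewrite Cartan //; apply: alternatingB; first exact: alternating_Lie.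
  exact/IHn/form_contract.
move=> b y c z; rewrite !Cartan // !contractD !contractN !contract_Lie.
rewrite (contract_br_skew gP b c y z).
case: n {IHn} g gP ag aig => [|n] g gP ag aig.
  by rewrite !Cartan0 !opprB opprK addrA.
rewrite !Cartan //; have [sg _] := ag; rewrite sg diffN.
by rewrite !opprK opprD !opprB !addrA [LHS](ACl (1*4*2*3)).
Qed.

(** Both sides have the same contractions, by Cartan's formula, [contract_Lie] and the
    commutation of Lie derivatives. *)
Theorem Lie_diff n b y (g : precochain V n) : sesquiform g ->
  diff (Lie b y g) = Lie b y (diff g).
Proof.
elim: n g => [|n IHn] g gP; apply: contract_inj => c z.
  by rewrite contract_Lie !Cartan0 -(Lie_br _ _ _ _ gP) opprB addrC subrK.
have ag := form_alternating gP; have aLg := alternating_Lie b y ag.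
rewrite contract_Lie !Cartan // contract_Lie diffB LieB.
rewrite -(IHn _ (form_contract _ _ gP)) -(Lie_br _ _ _ _ gP) !opprB !addrA.
by rewrite [RHS](ACl (4*3*2*(1*5))) /= subrr addr0.
Qed.

(** Cartan's formula twice: i d d = Lie d - d i d = Lie d - d Lie + d d i. *)
Theorem diff_diff n (g : precochain V n) : sesquiform g -> diff (diff g) = 0.
Proof.
elim: n g => [|n IHn] g gP; apply: contract_inj => b y;
  rewrite (Cartan _ _ (alternating_diff gP)).
  by rewrite Cartan0 Lie_diff // subrr.
rewrite (Cartan _ _ (form_alternating gP)) diffB Lie_diff //.
by rewrite IHn ?subr0 ?subrr //; apply: form_contract.
Qed.

Lemma perm_lift n (s : 'S_n.+1) : exists s', s = lift_perm ord0 (s ord0) s'.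
Proof.
pose f k := odflt k (unlift (s ord0) (s (lift ord0 k))).
have fK k : lift (s ord0) (f k) = s (lift ord0 k).
  rewrite /f; have := neq_lift ord0 k.
  by rewrite -(inj_eq (@perm_inj _ s)) => /unlift_some[? ? ->].
have f_inj : injective f.
  by move=> k l kl; apply/(@lift_inj _ ord0)/(@perm_inj _ s); rewrite -!fK kl.
exists (perm f_inj); apply/permP => i.
case: (unliftP ord0 i) => [k ->|->]; last by rewrite lift_perm_id.
by rewrite lift_perm_lift permE fK.
Qed.

Lemma upd_id U n (a : 'I_n -> U) i : upd a i (a i) = a.
Proof. by apply/funext => j; rewrite /upd; case: eqP => [->|]. Qed.

Lemma alternating_skew n (g : precochain V n) (s : 'S_n) a x : alternating g ->
  g (a \o s) (x \o s) = (-1) ^+ s *: g a x.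
Proof.
elim: n g s a x => [|n IHn] g s a x ag.
  have -> : s = 1%g by apply/permP => -[].
  by rewrite odd_perm1 scale1r; congr g; apply/funext => -[].
have [s' sE] := perm_lift s; set j := s ord0 in sE.
have E U (u : 'I_n.+1 -> U) : u \o s = fcons (u j) ((u \o lift j) \o s').
  by apply: ord_funP => [|k]; rewrite ?fcons0 ?fconsS // /= {1}sE lift_perm_lift.
have [_ aig] := ag; rewrite !E.
have := IHn _ s' (a \o lift j) (x \o lift j) (aig (a j) (x j)); rewrite /contract => ->.
rewrite alternating_move // !upd_id scalerA; congr (_ *: _).
by rewrite sE odd_lift_perm /= signr_addb signr_odd mulrC.
Qed.

Lemma alternating_slot n (g : precochain V n.+1) (i : 'I_n.+1) b a x : alternating g ->
  g (upd a i b) x = (-1) ^+ i *: contract b (x i) g (a \o lift i) (x \o lift i).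
Proof.
move=> ag; rewrite /contract alternating_move // upd_id scalerA -expr2 sqrr_sign.
by rewrite scale1r.
Qed.

(** By skew-symmetry, linearity and sesquilinearity need only be tested on the first
    argument, that is, on contractions. *)
Lemma sesquiformP n (g : precochain V n.+1) : alternating g ->
  (forall k b c y, contract (k *: b + c) y g = k *: contract b y g + contract c y g) ->
  (forall b y, contract (lca_der b) y g = - (y *: contract b y g)) -> sesquiform g.
Proof.
move=> ag gl gd; split=> // [i k b c a x|i a x].
  by rewrite !alternating_slot // gl !precochainE scalerDr !scalerA mulrC.
rewrite -[in RHS](upd_id a i) !alternating_slot // gd !precochainE scalerN !scalerA.
by rewrite mulrC.
Qed.

Lemma form_scale n (g : precochain V n) (i : 'I_n) k b a x : sesquiform g ->
  g (upd a i (k *: b)) x = k *: g (upd a i b) x.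
Proof.
move=> gP; have g0 : g (upd a i 0) x = 0.
  have := form_linear gP i 1 0 0 a x; rewrite !scale1r addr0 => /eqP.
  by rewrite -subr_eq0 opprD addNKr oppr_eq0 => /eqP.
by rewrite -(addr0 (k *: b)) form_linear // g0 addr0.
Qed.

Lemma form_sum n (g : precochain V n) (i : 'I_n) (I : Type) (r : seq I) (c : I -> K)
    (u : I -> A) a x : sesquiform g ->
  g (upd a i (\sum_(j <- r) c j *: u j)) x = \sum_(j <- r) c j *: g (upd a i (u j)) x.
Proof.
move=> gP; elim: r => [|j r IHr]; last by rewrite !big_cons form_linear // IHr.
by rewrite !big_nil -(scale0r (0 : A)) form_scale // scale0r.
Qed.

Lemma Lie_linear n k b c y (g : precochain V n) : sesquiform g ->
  Lie (k *: b + c) y g = k *: Lie b y g + Lie c y g.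
Proof.
move=> gP; apply: precochainP => a x; rewrite precochainD precochainZ !LieE lcm_act_linl.
under eq_bigr => j _ do rewrite lca_br_linl form_linear //.
by rewrite big_split -scaler_sumr opprD scalerBr addrACA.
Qed.

Lemma Lie_der n b y (g : precochain V n) : sesquiform g ->
  Lie (lca_der b) y g = - (y *: Lie b y g).
Proof.
move=> gP; apply: precochainP => a x; rewrite precochainN precochainZ !LieE lcm_act_derl.
under eq_bigr => j _ do rewrite lca_br_derl -scaleNr form_scale // scaleNr.
by rewrite sumrN -scaler_sumr scalerBr opprB opprK addrC.
Qed.

Theorem form_diff n (g : precochain V n) : sesquiform g -> sesquiform (diff g).
Proof.
move=> gP; apply: sesquiformP; first exact: alternating_diff.
  move=> k b c y; case: n g gP => [|n] g gP; first by rewrite !Cartan0 Lie_linear.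
  have ag := form_alternating gP.
  by rewrite !Cartan // Lie_linear // contract_linear // diffD diffZ opprD scalerBr addrACA.
move=> b y; case: n g gP => [|n] g gP; first by rewrite !Cartan0 Lie_der.
have ag := form_alternating gP.
by rewrite !Cartan // Lie_der // contract_der // diffN diffZ scalerBr opprK opprB addrC.
Qed.

Lemma polyfun_act n m (g : precochain V n) (c : 'I_m) b a (h : 'I_n -> 'I_m) :
  cochain g -> polyfun (fun x : 'I_m -> K => lcm_act (x c) b (g a (x \o h))).
Proof.
move=> [/(_ a)[N [u gE]] _ _ _].
apply: (@polyfun_ext _ _ _ (fun x => \sum_(l : {ffun 'I_n -> 'I_N})
    (\prod_i x (h i) ^+ l i) *: lcm_act (x c) b (u l))) => [x|].
  by rewrite gE /polysum act_sumr; apply: eq_bigr => l _; rewrite actZr.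
apply: polyfun_sum => l _; apply: polyfun_scaleM.
  by apply: polyfun_bigprod => i; apply/polyfun_exp/polyfun_coord.
have [M [w wE]] := lcm_act_poly b (u l).
apply: (@polyfun_ext _ _ _ (fun x => \sum_(k < M) x c ^+ k *: w k)) => [x|].
  by rewrite wE.
apply: polyfun_sum => k _; apply: polyfun_scaleM (polyfun_cst _ _).
exact/polyfun_exp/polyfun_coord.
Qed.

Lemma polyfun_br n m (g : precochain V n.+1) (c d : 'I_m) b b' a (h : 'I_n -> 'I_m) :
  cochain g -> polyfun (fun x : 'I_m -> K =>
    g (fcons (lca_br (x c) b b') a) (fcons (x c + x d) (x \o h))).
Proof.
move=> cg; have [N [u uE]] := lca_br_poly b b'.
apply: (@polyfun_ext _ _ _ (fun x => \sum_(k < N) x c ^+ k *: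
    g (fcons (u k) a) (fcons (x c + x d) (x \o h)))) => [x|].
  rewrite uE /polysum1 -(upd_fcons0 0 (\sum_(k < N) _)) form_sum; last exact: cochain_form.
  by apply: eq_bigr => k _; rewrite upd_fcons0.
apply: polyfun_sum => k _; apply: polyfun_scaleM.
  exact/polyfun_exp/polyfun_coord.
pose w i (x : 'I_m -> K) : K^o := fcons (x c + x d) (x \o h) i.
have [gp _ _ _] := cg; apply: (polyfun_comp (h := w) (gp (fcons (u k) a))) => i.
case: (unliftP ord0 i) => [j ->|->].
  by apply: polyfun_ext (polyfun_coord K (h j)) => x; rewrite /w fconsS.
by apply: polyfun_ext (polyfunD (polyfun_coord K c) (polyfun_coord K d)) => x; rewrite /w fcons0.
Qed.

(** The linear conditions come from [form_diff]; polynomiality is seen term by term. *)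
Theorem cochain_diff n (g : precochain V n) : cochain g -> cochain (diff g).
Proof.
move=> cg; have [dl dd da] := form_diff (cochain_form cg).
split=> [a||i a x|s a x]; [|exact: dl|exact: dd|exact: alternating_skew].
have act m (f : precochain V m) u : cochain f -> polyfun (diff_act f u).
  by move=> cf; apply: polyfun_sum => i _; apply/polyfun_scale/polyfun_act.
case: n g cg a {dl dd da} => [|n] g cg a; first exact: act.
apply: polyfunD (act _ _ _ cg) _.
apply: polyfun_sum => i _; apply: polyfun_sum => j _; apply/polyfun_scale.
exact: polyfun_br.
Qed.

Lemma actBr_der (x : K) b (v : V) k :
  lcm_act x b (lcm_der v + k *: v) = lcm_der (lcm_act x b v) + (x + k) *: lcm_act x b v.
Proof. by rewrite actDr actZr lcm_act_derr scalerDl addrA. Qed.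

Theorem diff_partial n (g : precochain V n) :
  diff (cochain_partial g) = cochain_partial (diff g).
Proof.
have E m (f : precochain V m) : diff_act (cochain_partial f) = cochain_partial (diff_act f).
  apply: precochainP => a x; rewrite /cochain_partial /diff_act.
  rewrite linear_sum scaler_sumr -big_split /=; apply: eq_bigr => i _.
  rewrite actBr_der (bigD1_ord i) //= linearZ /= scalerDr !scalerA; congr (_ + _ *: _).
  by rewrite mulrC.
case: n g => [|n] g; first exact: E.
have -> : cochain_partial (diff g) = cochain_partial (diff_act g) + cochain_partial (diff_br g).
  apply: precochainP => a x; rewrite precochainD /cochain_partial /= precochainD.
  by rewrite linearD scalerDr addrACA.
rewrite /= E; congr (_ + _); apply: precochainP => a x; rewrite /cochain_partial /diff_br.
rewrite linear_sum scaler_sumr -big_split /=; apply: eq_bigr => i _.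
rewrite linear_sum scaler_sumr -big_split /=; apply: eq_bigr => j _.
rewrite big_ord_recl fcons0 linearZ /= scalerDr !scalerA; congr (_ + _ *: _).
rewrite (bigD1_ord i) //= (bigD1_ord j) //= mulrC addrA; congr ((_ + _) * _).
by apply: eq_bigr => k _; rewrite fconsS.
Qed.

End CartanCalculus.

(** * The homotopy given by an energy element *)
Section EnergyHomotopy.
Local Open Scope classical_set_scope.
Variables (K : numFieldType) (A : lieConformal K) (V : lcaModule A).
Implicit Types n : nat.

Lemma cochain_partialD n (f g : precochain V n) :
  cochain_partial (f + g) = cochain_partial f + cochain_partial g.
Proof.
apply: precochainP => a x; rewrite precochainD /cochain_partial precochainD linearD.
by rewrite scalerDr addrACA.
Qed.

Lemma cochain_partialZ n k (g : precochain V n) :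
  cochain_partial (k *: g) = k *: cochain_partial g.
Proof.
apply: precochainP => a x; rewrite precochainZ /cochain_partial precochainZ linearZ /=.
by rewrite scalerDr !scalerA mulrC.
Qed.

Lemma cochain_partialN n (g : precochain V n) :
  cochain_partial (- g) = - cochain_partial g.
Proof. by rewrite -scaleN1r cochain_partialZ scaleN1r. Qed.

Lemma cochain_partialB n (f g : precochain V n) :
  cochain_partial (f - g) = cochain_partial f - cochain_partial g.
Proof. by rewrite cochain_partialD cochain_partialN. Qed.

Lemma cochain_partial0 n : cochain_partial (0 : precochain V n) = 0.
Proof. apply: precochainP => a x; rewrite /cochain_partial linear0 scaler0 addr0. by []. Qed.

Lemma contract_partial n b (g : precochain V n.+1) :
  contract b 0 (cochain_partial g) =cochain_partial (contract b 0 g).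
Proof.
apply: precochainP => a x; rewrite /contract /cochain_partial big_ord_recl fcons0 add0r.
by under eq_bigr => i _ do rewrite fconsS.
Qed.

(** E plays the role of the Virasoro element L, whose zero mode is a derivation that
    coincides with der on A and differs from der by the scalar c on V. *)
Variables (E : A) (c : K).
Hypothesis brE : forall b, lca_br 0 E b = lca_der b.
Hypothesis actE : forall v : V, lcm_act 0 E v = lcm_der v + c *: v.

(** Replacing a_j by [E_0 a_j] = der a_j multiplies g by - x_j, so the Lie derivative is
    partial, with its term for each indeterminate, shifted by c. *)
Lemma Lie_energy n (g : precochain V n) : sesquiform g ->
  Lie E 0 g = cochain_partial g + c *: g.
Proof.
move=> gP; apply: precochainP => a x; rewrite precochainD precochainZ LieE actE.
rewrite /cochain_partial addrAC; congr (_ + _); rewrite scaler_suml -sumrN.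
congr (_ + _); apply: eq_bigr => j _.
rewrite brE add0r (_ : upd x j (x j) = x); last first.
  by apply/funext => i; rewrite /upd; case: eqP => [->|].
by rewrite (form_der gP) opprK.
Qed.

Lemma energy_homotopy0 (g : precochain V 0) : cochain g ->
  contract E 0 (diff g) = cochain_partial g + c *: g.
Proof. by move=> cg; rewrite Cartan0 Lie_energy //; apply: cochain_form. Qed.

Lemma energy_homotopy n (g : precochain V n.+1) : cochain g ->
  contract E 0 (diff g) + diff (contract E 0 g) = cochain_partial g + c *: g.
Proof.
move=> cg; rewrite Cartan; last exact: cochain_alternating.
by rewrite subrK Lie_energy //; apply: cochain_form.
Qed.

(** If d g = partial h then c g = d (i g) + partial (i h - g). *)
Theorem reducedH_vanish q : c != 0 -> is_zero (reducedH V q).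
Proof.
move=> c0; case: q => [|q] g /= [cg [h ch dh]].
  exists (c^-1 *: (contract E 0 h - g)).
    by apply/cochainZ/cochainB => //; apply: cochain_contract.
  rewrite cochain_partialZ cochain_partialB -contract_partial dh energy_homotopy0 //.
  by rewrite addrAC subrr add0r; exact: (scalerK c0).
exists (c^-1 *: contract E 0 g); first exact/cochainZ/cochain_contract.
exists (c^-1 *: (contract E 0 h - g)).
  by apply/cochainZ/cochainB => //; apply: cochain_contract.
rewrite cochain_partialZ cochain_partialB -contract_partial dh diffZ.
have -> : contract E 0 (diff g) - cochain_partial g = c *: g - diff (contract E 0 g).
  have := energy_homotopy cg => /(canRL (addrK _)) ->.
  by rewrite addrAC [cochain_partial g + _]addrC addrK.
by rewrite scalerBr (scalerK c0).
Qed.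

End EnergyHomotopy.

Section HVVanishing.
Variable K : numFieldType.

Lemma HVbr_energy (b : HV K) : lca_br 0 (HVL K : HV K) b = lca_der b.
Proof.
by case: b => b1 b2; congr (_, _); apply: poly_ext => t;
  rewrite /sesqui !(hornerE, horner_comp) /=; ring.
Qed.

Lemma Cmod_vanish (a : K) q : a != 0 -> is_zero (reducedH (Cmod a) q).
Proof.
move=> a0; apply: (@reducedH_vanish K (HV K) (Cmod a) (HVL K) (- a) HVbr_energy).
  by move=> v; rewrite /= /Cact /Cder scaleNr subrr.
by rewrite oppr_eq0.
Qed.

Lemma Mmod_vanish (Delta alpha : K) q : alpha != 0 -> is_zero (reducedH (Mmod Delta alpha) q).
Proof.
apply: (@reducedH_vanish K (HV K) (Mmod Delta alpha) (HVL K) alpha HVbr_energy).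
by move=> v; apply: poly_ext => t; rewrite /= /Mact /Mder /sesqui !(hornerE, horner_comp) /=; ring.
Qed.

End HVVanishing.

(** * Reduced cohomology of the trivial module *)
Section ReducedFromBasic.
Local Open Scope classical_set_scope.
Variable K : numFieldType.
Local Notation T := (trivialMod K).
Local Notation E := (HVL K : HV K).
Implicit Types n q : nat.

Lemma trivial_diff n (g : precochain T n) : diff_act g = 0.
Proof. by apply: precochainP => a x; rewrite /diff_act big1 // => i _; rewrite scaler0. Qed.

Lemma trivial_partial n (g : precochain T n) a x :
  cochain_partial g a x = (\sum_i x i) * g a x.
Proof. by rewrite /cochain_partial /= /Cder scale0r add0r. Qed.

Lemma contract_poly n (g : precochain T n.+1) b a x : cochain g ->
  exists p : {poly K}, forall y, contract b y g a x = p.[y].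
Proof.
move=> [/(_ (fcons b a)) [N [c gE]] _ _ _].
exists (\sum_(m : {ffun 'I_n.+1 -> 'I_N})
  ((\prod_i x i ^+ m (lift ord0 i)) * c m) *: 'X^(m ord0)) => y.
rewrite /contract gE horner_sum; apply: eq_bigr => m _.
rewrite hornerZ hornerXn big_ord_recl fcons0 [RHS]mulrC [RHS]mulrA; congr (_ * _ * _).
by apply: eq_bigr => i _; rewrite fconsS.
Qed.

(** partial multiplies by the sum of the indeterminates, which is not a zero divisor. *)
Lemma partial_inj n (f : precochain T n.+1) : cochain f -> cochain_partial f = 0 -> f = 0.
Proof.
move=> cf f0; apply: contract_inj => b y; apply: precochainP => a x.
have [p pE] := contract_poly b a x cf; rewrite pE; apply: (_ : p.[y] = 0).
have Z s : (\sum_i x i + s) * p.[s] = 0.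
  rewrite -pE /contract; have := congr1 (fun h : precochain T _ => h (fcons b a) (fcons s x)) f0.
  rewrite trivial_partial big_ord_recl fcons0 => /(etrans _); apply.
  by congr (_ * _); rewrite addrC; congr (_ + _); apply: eq_bigr => i _; rewrite fconsS.
have : ((\sum_i x i)%:P + 'X) * p = 0.
  by apply: poly_ext => s; rewrite !hornerE Z.
move/eqP; rewrite mulf_eq0 => /orP[|/eqP->]; last by rewrite horner0.
by rewrite addrC -size_poly_eq0 size_XaddC.
Qed.

Lemma trivial_homotopy n (g : precochain T n.+1) : cochain g ->
  contract E 0 (diff g) + diff (contract E 0 g) = cochain_partial g.
Proof.
move=> cg; rewrite (@energy_homotopy K (HV K) T E 0 (@HVbr_energy K)) ?scale0r ?addr0 //.
by move=> v; rewrite /= /Cact /Cder !scale0r addr0.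
Qed.

(** Classes in the reduced complex come from two sources: basic cocycles e of the same
    degree, and contractions i f of basic cocycles f of the next degree, for which
    d (i f) = partial f.  The connecting map sends g with d g = partial h to the class of
    h; it maps i f to f, and no relation is lost because partial is homotopic to zero. *)
Theorem reduced_of_basic q m n :
  has_dim (basicH T q.+1) m -> has_dim (basicH T q.+2) n ->
  has_dim (reducedH T q.+1) (m + n).
Proof.
move=> [e [eN eF eS]] [f [fN fF fS]].
pose u (i : 'I_(m + n)) : precochain T q.+1 :=
  match fintype.split i with inl j => e j | inr k => contract E 0 (f k) end.
have ul i : u (lshift n i) = e i by rewrite /u (unsplitK (inl i)).
have ur i : u (rshift m i) = contract E 0 (f i) by rewrite /u (unsplitK (inr i)).
have ce i : cochain (e i) by have [] := eN i.
have cf i : cochain (f i) by have [] := fN i.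
have de i : diff (e i) = 0 by have [] := eN i.
have df i : diff (f i) = 0 by have [] := fN i.
have cle k : cochain (\sum_i k i *: e i) by apply: cochain_sum => i _; apply: cochainZ.
have clf k : cochain (\sum_i k i *: f i) by apply: cochain_sum => i _; apply: cochainZ.
have dle k : diff (\sum_i k i *: e i) = 0.
  by rewrite diff_sum big1 // => i _; rewrite diffZ de scaler0.
have dlf k : diff (contract E 0 (\sum_i k i *: f i)) = cochain_partial (\sum_i k i *: f i).
  rewrite -trivial_homotopy // (_ : diff (\sum_i _) = 0) ?[RHS]add0r //.
  by rewrite diff_sum big1 // => i _; rewrite diffZ df scaler0.
have uE (k : 'I_(m + n) -> K) : \sum_i k i *: u i
    = \sum_i k (lshift n i) *: e i + contract E 0 (\sum_i k (rshift m i) *: f i).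
  rewrite big_split_ord /=; congr (_ + _); first by apply: eq_bigr => i _; rewrite ul.
  under eq_bigr => i _ do rewrite ur.
  by rewrite contract_sumr; apply: eq_bigr => i _; rewrite contractZ.
exists u; split.
- move=> i; rewrite -(splitK i); case: (fintype.split i) => j /=; rewrite ?ul ?ur.
    split=> //; exists 0; first exact: cochain0.
    by rewrite cochain_partial0; apply: esym (de j).
  split; first exact: cochain_contract.
  exists (f j) => //; rewrite -(trivial_homotopy (cf j)) df contract0 add0r.
  by [].
- move=> k [b cb [h ch]]; rewrite uE => hE.
  (* Applying d kills the classes e and turns i f into partial f; divide by partial. *)
  have dh : \sum_i k (rshift m i) *: f i = diff h.
    apply/eqP; rewrite -subr_eq0; apply/eqP/partial_inj.
      exact/cochainB/cochain_diff.
    rewrite cochain_partialB -diff_partial hE.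
    by rewrite diffB diffD dle dlf add0r diff_diff ?subr0 ?subrr //; apply: cochain_form.
  have k2 i : k (rshift m i) = 0 by move: i; apply: fF; exists h => //=; rewrite dh subrr.
  have f0 : \sum_i k (rshift m i) *: f i = 0 by rewrite big1 // => i _; rewrite k2 scale0r.
  move: hE; rewrite f0 addr0 => hE.
  have k1 i : k (lshift n i) = 0.
    move: i; apply: eF; exists (b + contract E 0 h); first by apply/cochainD/cochain_contract.
    rewrite /= diffD opprD addrA -hE -trivial_homotopy // -dh f0.
    by rewrite add0r subrr.
  by move=> i; rewrite -(splitK i); case: (fintype.split i).
- move=> g [cg [h ch /esym dg]]; rewrite -/(diff g) in dg.
  have dh : diff h = 0.
    apply: partial_inj; first exact: cochain_diff.
    by rewrite -diff_partial -dg diff_diff //; apply: cochain_form.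
  have [l [k' ck' lE]] := fS h (conj ch dh).
  have hE : h = \sum_i l i *: f i + diff k'.
    by apply/eqP; rewrite addrC -subr_eq -subr_eq0; apply/eqP; exact: lE.
  (* g and i h have the same image under the connecting map. *)
  have dg' : diff (g - contract E 0 h) = 0.
    by rewrite diffB dg -(trivial_homotopy ch) dh contract0 add0r subrr.
  have [k [b cb kE]] := eS _ (conj (cochainB cg (cochain_contract E 0 ch)) dg').
  exists (fun i => match fintype.split i with inl j => k j | inr j => l j end).
  exists (b - contract E 0 k'); first exact/cochainB/cochain_contract.
  exists k' => //; rewrite uE.
  have -> : \sum_i (match fintype.split (lshift n i) with inl j => k j | inr j => l j end) *: e i
      = \sum_i k i *: e i.
    by apply: eq_bigr => i _; rewrite (unsplitK (inl i)).
  have -> : \sum_i (match fintype.split (rshift m i) with inl j => k j | inr j => l j end) *: f i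
      = \sum_i l i *: f i.
    by apply: eq_bigr => i _; rewrite (unsplitK (inr i)).
  apply/eqP; rewrite eq_sym -subr_eq0; apply/eqP; rewrite -[RHS]kE.
  rewrite -trivial_homotopy // diffB hE (contractD _ _ (\sum_i l i *: f i)).
  move: (contract E 0 _) (contract E 0 (diff k')) (diff _) (diff b) => x1 x2 x3 x4.
  move: (\sum_i _) => x5.
  rewrite !opprD !opprK !addrA [LHS](ACl (1*3*6*2*4*(5*7))) /= subrr addr0.
  by [].
Qed.

End ReducedFromBasic.

(** * Exterior products of coordinate functionals *)
Section Wedges.
Variable K : numFieldType.
Local Notation T := (trivialMod K).
Local Notation E := (HVL K : HV K).
Implicit Types q D : nat.

(** (true, m) stands for L_m and (false, m) for M_m. *)
Definition coordinate := (bool * nat)%type.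

Definition coord_eval (t : coordinate) (a : HVsort K) (x : K) : K :=
  (if t.1 then a.1 else a.2).[- x] * x ^+ t.2.

Definition wedge q (t : q.-tuple coordinate) : precochain T q := fun a x =>
  \det (\matrix_(j, i) coord_eval (tnth t i) (a j) (x j)).

(** The tensor product of the functionals, of which the exterior product is the
    skew-symmetrization. *)
Definition monomial q (t : q.-tuple coordinate) : precochain T q := fun a x =>
  \prod_j coord_eval (tnth t j) (a j) (x j).

Lemma coord_eval_linear t k a b x :
  coord_eval t (k *: a + b) x = k * coord_eval t a x + coord_eval t b x.
Proof. by rewrite /coord_eval; case: t.1; rewrite /= hornerD hornerZ; ring. Qed.

Lemma coord_eval_der t a x : coord_eval t (HVder a) x = - (x * coord_eval t a x).
Proof. by rewrite /coord_eval; case: t.1; rewrite /= hornerM hornerX; ring. Qed.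

Lemma wedgeE q (t : q.-tuple coordinate) :
  wedge t = \sum_(s : 'S_q) (-1) ^+ s *: monomial [tuple tnth t (s i) | i < q].
Proof.
apply: precochainP => a x; rewrite precochain_sum /wedge /determinant.
apply: eq_bigr => s _; rewrite precochainZ; congr (_ * _).
by apply: eq_bigr => j _; rewrite mxE tnth_mktuple.
Qed.

Lemma wedge_perm q (t : q.-tuple coordinate) (s : 'S_q) :
  wedge [tuple tnth t (s i) | i < q] = (-1) ^+ s *: wedge t.
Proof.
apply: precochainP => a x; rewrite precochainZ /wedge.
set M := (\matrix_(j, i) coord_eval (tnth t i) _ _).
rewrite (_ : (\matrix_(j, i) _) = col_perm s M); last first.
  by apply/matrixP => j i; rewrite !mxE tnth_mktuple.
by rewrite col_permE det_mulmx det_perm odd_permV mulrC.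
Qed.

Lemma cochain_wedge q (t : q.-tuple coordinate) : cochain (wedge t).
Proof.
split=> [a|i k u v a x|i a x|s a x].
- rewrite wedgeE.
  pose p (s : 'S_q) j : {poly K} :=
    ((if (tnth t (s j)).1 then (a j).1 else (a j).2) \Po (- 'X)) * 'X^((tnth t (s j)).2).
  have: polyfun (fun x : 'I_q -> K => \sum_(s : 'S_q)
      (\prod_j (p s j).[x j]) *: ((-1) ^+ s : K^o)).
    by apply: polyfun_sum => s _; apply: polyfun_prod.
  apply: polyfun_ext => x; rewrite precochain_sum; apply: eq_bigr => s _.
  rewrite precochainZ /monomial [LHS]mulrC; congr (_ * _); apply: eq_bigr => j _.
  by rewrite /p tnth_mktuple hornerM horner_comp !hornerE.
- rewrite !etaE /wedge; rewrite -[X in _ = _ + X]mul1r.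
  apply: (determinant_multilinear (i0 := i)).
  + by apply/rowP => l; rewrite !mxE /upd eqxx coord_eval_linear mul1r.
  + by apply/matrixP => j l; rewrite !mxE /upd eq_sym (negbTE (neq_lift _ _)).
  + by apply/matrixP => j l; rewrite !mxE /upd eq_sym (negbTE (neq_lift _ _)).
- rewrite !etaE /wedge -[RHS]mulNr -[RHS]addr0 -(mul0r (wedge t a x)).
  apply: (determinant_multilinear (i0 := i)).
  + by apply/rowP => l; rewrite !mxE /upd eqxx coord_eval_der mul0r addr0 mulNr.
  + by apply/matrixP => j l; rewrite !mxE /upd eq_sym (negbTE (neq_lift _ _)).
  + by apply/matrixP => j l; rewrite !mxE /upd eq_sym (negbTE (neq_lift _ _)).
- rewrite /wedge; set M := (\matrix_(j, i) coord_eval _ (a j) _).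
  rewrite (_ : (\matrix_(j, i) _) = row_perm s M); last first.
    by apply/matrixP => j i; rewrite !mxE.
  by rewrite row_permE det_mulmx det_perm.
Qed.

Lemma wedge_repeat q (t : q.-tuple coordinate) : ~~ uniq t -> wedge t = 0.
Proof.
move=> /tuple_uniqP nt; apply: precochainP => a x.
have [i [j [ij tij]]] : exists i j, i != j /\ tnth t i = tnth t j.
  apply: contra_notP nt => H i j tij; apply/eqP; apply: contra_notT H => ij.
  by exists i, j.
rewrite /wedge -det_tr; apply: (determinant_alternate ij) => l.
by rewrite !mxE tij.
Qed.

(** Linear combinations are encoded by lists of coefficients and products, so that the
    span is closed under sums by concatenation. *)
Definition combination q (s : seq (K * q.-tuple coordinate)) : precochain T q :=
  \sum_(p <- s) p.1 *: wedge p.2.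

Lemma cochain_combination q (s : seq (K * q.-tuple coordinate)) : cochain (combination s).
Proof. by apply: cochain_sum => p _; apply/cochainZ/cochain_wedge. Qed.

Lemma combination_sum q (I : Type) (r : seq I) (P : pred I) (F : I -> precochain T q) :
  (forall i, P i -> exists s, F i = combination s) ->
  exists s, \sum_(i <- r | P i) F i = combination s.
Proof.
move=> FP; elim/big_ind: _ => [|f g [s ->] [s' ->]|i /FP //].
  by exists [::]; rewrite /combination big_nil.
by exists (s ++ s'); rewrite /combination big_cat.
Qed.

Lemma combinationZ q k (s : seq (K * q.-tuple coordinate)) :
  k *: combination s = combination [seq (k * p.1, p.2) | p <- s].
Proof.
by rewrite /combination scaler_sumr big_map; apply: eq_bigr => p _; rewrite scalerA.
Qed.

Lemma sum_ffun_ordS (W : nmodType) (I : finType) q (F : {ffun 'I_q.+1 -> I} -> W) :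
  \sum_(f : {ffun 'I_q.+1 -> I}) F f
    = \sum_(i : I) \sum_(f : {ffun 'I_q -> I}) F [ffun j => fcons i f j].
Proof.
rewrite pair_bigA /=; apply: reindex; apply: onW_bij.
exists (fun f : {ffun 'I_q.+1 -> I} => (f ord0, [ffun j => f (lift ord0 j)])).
  move=> [i f] /=; rewrite ffunE fcons0; congr (_, _).
  by apply/ffunP => j; rewrite !ffunE fconsS.
move=> f; apply/ffunP => j; rewrite ffunE /=.
case: (unliftP ord0 j) => [l ->|->]; rewrite ?fcons0 ?fconsS ?ffunE //.
Qed.

Definition HVgen (b : bool) : HV K := if b then HVL K else HVM K.

(** Sesquilinearity: der may be replaced by minus the indeterminate. *)
Lemma contract_gen q (g : precochain T q.+1) (b : HV K) y : sesquiform g ->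
  contract b y g = \sum_(e : bool) (if e then b.1 else b.2).[- y] *: contract (HVgen e) y g.
Proof.
move=> gP; have pol (p : {poly K}) (u : HV K) :
    contract ((p * u.1, p * u.2) : HV K) y g = p.[- y] *: contract u y g.
  elim/poly_ind: p => [|p c IHp].
    by rewrite !mul0r horner0 scale0r; apply: (contract0l gP).
  have -> : (((p * 'X + c%:P) * u.1, (p * 'X + c%:P) * u.2) : HV K)
      = lca_der ((p * u.1, p * u.2) : HV K) + c *: u.
    by congr (_, _); rewrite /= -mul_polyC; ring.
  rewrite (contractDl gP) (contract_der gP) (contractZl gP) IHp !hornerE.
  by rewrite scalerDl scalerA mulrN scaleNr mulrC.
have {1}-> : b = ((b.1 * (HVL K).1, b.1 * (HVL K).2) : HV K)
    + ((b.2 * (HVM K).1, b.2 * (HVM K).2) : HV K).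
  by case: b => b1 b2; congr (_, _); rewrite /= ?mulr1 ?mulr0 ?addr0 ?add0r.
by rewrite (contractDl gP) !pol big_bool.
Qed.

Lemma sesquiform_expand q (g : precochain T q) a x : sesquiform g ->
  g a x = \sum_(e : {ffun 'I_q -> bool})
    (\prod_i (if e i then (a i).1 else (a i).2).[- x i]) * g (HVgen \o e) x.
Proof.
elim: q g a x => [|q IHq] g a x gP.
  rewrite (bigD1 [ffun=> true]) //= big_ord0 mul1r big1 ?addr0.
    by congr g; apply/funext => -[].
  by move=> e /eqP []; apply/ffunP => -[].
rewrite sum_ffun_ordS -{1}(fcons_eta a) -{1}(fcons_eta x).
rewrite -/(contract (a ord0) (x ord0) g _ _) contract_gen // precochain_sum.
apply: eq_bigr => b _; rewrite precochainZ (IHq _ _ _ (form_contract _ _ gP)).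
rewrite [LHS]mulr_sumr; apply: eq_bigr => e _.
rewrite big_ord_recl !ffunE fcons0 mulrA; congr (_ * _ * _).
  by apply: eq_bigr => i _; rewrite ffunE fconsS.
rewrite /contract -{3}(fcons_eta x); congr (g _ _).
by apply: ord_funP => [|i] /=; rewrite ffunE ?fcons0 ?fconsS.
Qed.

Definition skewing q (g : precochain T q) : precochain T q := fun a x =>
  \sum_(s : 'S_q) (-1) ^+ s * g (a \o s) (x \o s).

Lemma skewing_sum q (I : Type) (r : seq I) (F : I -> precochain T q) :
  skewing (\sum_(i <- r) F i) = \sum_(i <- r) skewing (F i).
Proof.
apply: precochainP => a x; rewrite precochain_sum /skewing.
under eq_bigr => s _ do rewrite precochain_sum mulr_sumr.
exact: exchange_big.
Qed.

Lemma skewingZ q k (g : precochain T q) : skewing (k *: g) = k *: skewing g.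
Proof.
apply: precochainP => a x; rewrite precochainZ /skewing [RHS]mulr_sumr.
by apply: eq_bigr => s _; rewrite precochainZ mulrCA.
Qed.

Lemma skewing_cochain q (g : precochain T q) : cochain g -> skewing g = q`!%:R *: g.
Proof.
move=> [_ _ _ gs]; apply: precochainP => a x; rewrite precochainZ /skewing.
under eq_bigr => s _ do rewrite gs [_ *: _]/GRing.scale /= mulrA -expr2 sqrr_sign mul1r.
by rewrite sumr_const card_Sn -[LHS]mulr_natl.
Qed.

Lemma skewing_monomial q (t : q.-tuple coordinate) : skewing (monomial t) = wedge t.
Proof.
apply: precochainP => a x; rewrite /wedge -det_tr; apply: eq_bigr => s _.
by congr (_ * _); apply: eq_bigr => j _; rewrite !mxE.
Qed.

(** Expanding the arguments on generators and the values in monomials of the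
    indeterminates writes a cochain as a combination of tensor products; applying the
    skew-symmetrization, which multiplies a cochain by q!, makes them exterior. *)
Theorem cochain_combinationP q (g : precochain T q) : cochain g ->
  exists s, g = combination s.
Proof.
move=> cg; have [gp _ _ _] := cg.
pose F (e : {ffun 'I_q -> bool}) : precochain T q := fun a x =>
  (\prod_i (if e i then (a i).1 else (a i).2).[- x i]) * g (HVgen \o e) x.
have gE : g = \sum_e F e.
  apply: precochainP => a x; rewrite precochain_sum.
  exact/sesquiform_expand/cochain_form.
have -> : g = q`!%:R^-1 *: \sum_e skewing (F e).
  rewrite -skewing_sum -gE skewing_cochain // scalerK //.
  by rewrite pnatr_eq0 -lt0n fact_gt0.
have [s ->] : exists s, \sum_e skewing (F e) = combination s.
  apply: combination_sum => e _; have [N [c cE]] := gp (HVgen \o e).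
  pose t (m : {ffun 'I_q -> 'I_N}) := [tuple (e i, nat_of_ord (m i)) | i < q].
  have -> : F e = \sum_m c m *: monomial (t m).
    apply: precochainP => a x; rewrite precochain_sum /F cE [LHS]mulr_sumr.
    apply: eq_bigr => m _; rewrite precochainZ [RHS]mulrC [X in _ * X = _]/GRing.scale /= mulrA.
    congr (_ * _); rewrite -big_split; apply: eq_bigr => i _.
    by rewrite tnth_mktuple.
  rewrite skewing_sum; apply: combination_sum => m _.
  exists [:: (c m, t m)]; rewrite skewingZ skewing_monomial.
  by rewrite /combination big_seq1.
by eexists; rewrite combinationZ.
Qed.

End Wedges.

(** * Reduction to weight zero *)
Section Weights.
Variable K : numFieldType.
Local Notation T := (trivialMod K).
Local Notation E := (HVL K : HV K).
Implicit Types q D : nat.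

(** Extracting the coefficient of degree 1 is a fixed linear combination of evaluations, as
    long as the degree is bounded.  So the coefficient of y in the Lie derivative
    Lie_(L,y) is a finite combination of Lie derivatives, to which the Cartan calculus
    applies term by term. *)
Lemma coef1_nodes D : exists w : 'I_D.+2 -> K, forall p : {poly K},
  (size p <= D.+2)%N -> \sum_k w k * p.[k%:R] = p`_1.
Proof.
pose M : 'M[K]_D.+2 := Vandermonde D.+2 (\row_(j < D.+2) (j%:R : K)).
have uM : M \in unitmx.
  rewrite unitmxE det_Vandermonde unitfE.
  apply/prodf_neq0 => i _; apply/prodf_neq0 => j ltij.
  by rewrite !mxE subr_eq0 eqr_nat eq_sym ltn_eqF.
pose i1 : 'I_D.+2 := Ordinal (isT : 1 < D.+2)%N.
exists (fun j => invmx M j i1) => p sp.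
under eq_bigr => j _ do rewrite (horner_coef_wide _ sp) mulr_sumr.
rewrite exchange_big (bigD1 i1) //= [X in _ + X]big1 ?addr0 => [|i ni].
  have := congr1 (fun B : 'M[K]_D.+2 => B i1 i1) (mulmxV uM).
  rewrite !mxE eqxx => H; rewrite -[RHS]mulr1 -[X in _ = _ * X]H mulr_sumr.
  by apply: eq_bigr => j _; rewrite !mxE mulrCA (mulrC (invmx _ _ _)).
have := congr1 (fun B : 'M[K]_D.+2 => B i i1) (mulmxV uM).
rewrite !mxE (negbTE ni) => H; rewrite -[RHS](mulr0 (p`_i)) -[X in _ = _ * X]H mulr_sumr.
by apply: eq_bigr => j _; rewrite !mxE mulrCA (mulrC (invmx _ _ _)).
Qed.

Definition nodes D : 'I_D.+2 -> K := projT1 (cid (coef1_nodes D)).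


Arguments nodes : clear implicits.

Lemma nodesP D (p : {poly K}) :
  (size p <= D.+2)%N -> \sum_k nodes D k * p.[k%:R] = p`_1.
Proof. exact: (projT2 (cid (coef1_nodes D))). Qed.

(** The coefficient of y in Lie_(L,y), on cochains of degree at most D in each
    indeterminate. *)
Definition euler D q (g : precochain T q) : precochain T q :=
  \sum_(k < D.+2) nodes D k *: Lie E k%:R g.

Lemma euler_sum D q (I : Type) (r : seq I) (F : I -> precochain T q) :
  euler D (\sum_(i <- r) F i) = \sum_(i <- r) euler D (F i).
Proof.
rewrite exchange_big; apply: eq_bigr => k _ /=; rewrite -scaler_sumr; congr (_ *: _).
have Lie0 : Lie E k%:R (0 : precochain T q) = 0.
  by have := LieB E k%:R (0 : precochain T q) 0; rewrite !subrr.
exact: (big_morph _ (@LieD _ _ _ q E k%:R) Lie0).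
Qed.

Lemma eulerZ D q c (g : precochain T q) : euler D (c *: g) = c *: euler D g.
Proof.
rewrite /euler scaler_sumr; apply: eq_bigr => k _.
by rewrite LieZ !scalerA mulrC.
Qed.

Lemma diff_euler D q (g : precochain T q) : sesquiform g ->
  diff (euler D g) = euler D (diff g).
Proof.
by move=> gP; rewrite diff_sum; apply: eq_bigr => k _; rewrite diffZ Lie_diff.
Qed.

(** Cartan's formula: the Euler operator is homotopic to zero. *)
Lemma euler_exact D q (g : precochain T q.+1) : cochain g -> diff g = 0 ->
  exists2 b, cochain b & euler D g = diff b.
Proof.
move=> cg dg; exists (\sum_(k < D.+2) nodes D k *: contract E k%:R g).
  by apply: cochain_sum => k _; apply/cochainZ/cochain_contract.
rewrite diff_sum; apply: eq_bigr => k _; rewrite diffZ; congr (_ *: _).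
have := Cartan E k%:R (cochain_alternating cg); rewrite dg contract0.
by move/esym/eqP; rewrite subr_eq0 => /eqP.
Qed.

Definition coord_weight (t : coordinate) : K := t.2%:R - t.1%:R.

Definition weight q (t : q.-tuple coordinate) : K := \sum_i coord_weight (tnth t i).

(** The brackets [L_y L] = (der + 2y) L and [L_y M] = (der + y) M give (y - x) (y + x)^m and
    - x (y + x)^m, whose coefficients of y are (1 - m) x^m and - m x^m. *)
Lemma coord_eval_bracket t a x : exists p : {poly K},
  [/\ (size p <= t.2.+2)%N,
      forall y, coord_eval t (HVbr y (HVL K) a) (y + x) = p.[y]
    & p`_1 = - coord_weight t * coord_eval t a x].
Proof.
case: t => b m; rewrite /coord_weight /coord_eval /=.
have sX : (size (('X + x%:P) ^+ m) <= m.+1)%N.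
  by rewrite (leq_trans (size_poly_exp_leq _ _)) // size_XaddC mul1n.
have cX (p : {poly K}) : p`_1 = p^`().[0] by rewrite horner_coef0 coef_deriv mulr1n.
have dX : (('X + x%:P) ^+ m)^`() = ('X + x%:P) ^+ m.-1 *+ m.
  by rewrite deriv_exp derivD derivX derivC addr0 mul1r.
have mX : x * (x ^+ m.-1 *+ m) = m%:R * x ^+ m.
  by case: m {sX dX} => [|m]; rewrite ?mulr0n ?mulr0 ?mul0r // exprS mulr_natl mulrnAr.
case: b => /=.
  exists ((a.1).[- x] *: (('X - x%:P) * ('X + x%:P) ^+ m)); split.
  - apply: (leq_trans (size_scale_leq _ _)); apply: (leq_trans (size_polyMleq _ _)).
    by rewrite size_XsubC.
  - move=> y; have A : - (y + x) + y = - x by ring.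
    by rewrite /sesqui !(hornerE, horner_comp, horner_exp) /= A; ring.
  rewrite cX derivZ derivM dX derivB derivX derivC subr0 mul1r.
  by rewrite !(hornerE, horner_exp, hornerMn) /= mulNr mX; ring.
exists (((a.2).[- x] * - x) *: ('X + x%:P) ^+ m); split.
- exact: leq_trans (size_scale_leq _ _) (leq_trans sX _).
- move=> y; have A : - (y + x) + y = - x by ring.
  by rewrite /sesqui !(hornerE, horner_comp, horner_exp) /= A; ring.
rewrite cX derivZ dX !(hornerE, horner_exp, hornerMn) /=.
by rewrite -(mulrA a.2.[- x]) mulNr mX; ring.
Qed.

Lemma weight_perm q (t : q.-tuple coordinate) (s : 'S_q) :
  weight [tuple tnth t (s i) | i < q] = weight t.
Proof.
rewrite /weight [RHS](reindex_inj (@perm_inj _ s)) /=.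
by apply: eq_bigr => i _; rewrite tnth_mktuple.
Qed.

Lemma euler_monomial D q (t : q.-tuple coordinate) :
  (forall i, ((tnth t i).2 <= D)%N) -> euler D (monomial t) = weight t *: monomial t.
Proof.
move=> tD; apply: precochainP => a x; rewrite /euler precochain_sum precochainZ.
have pP (j : 'I_q) : exists p : {poly K},
  [/\ (size p <= D.+2)%N, forall y, monomial t (upd a j (HVbr y (HVL K) (a j)))
          (upd x j (y + x j)) = p.[y]
    & p`_1 = - coord_weight (tnth t j) * monomial t a x].
  have [p [sp pE p1]] := coord_eval_bracket (tnth t j) (a j) (x j).
  pose r := \prod_(i | i != j) coord_eval (tnth t i) (a i) (x i).
  exists (r *: p); split.
      by apply: leq_trans (size_scale_leq _ _) (leq_trans sp _); rewrite !ltnS.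
    move=> y; rewrite hornerZ -pE /monomial (bigD1 j) //= /upd eqxx [RHS]mulrC.
    by congr (_ * _); apply: eq_bigr => i /negbTE ->.
  by rewrite coefZ p1 /monomial (bigD1 j) //= mulrCA [r * _]mulrC.
have {pP} [p pP] := choice pP.
transitivity (\sum_(k < D.+2) \sum_j - (nodes D k * (p j).[k%:R])).
  apply: eq_bigr => k _; rewrite precochainZ LieE /= /Cact sub0r -sumrN [LHS]mulr_sumr.
  by apply: eq_bigr => j _; have [_ <- _] := pP j; rewrite mulrN.
rewrite exchange_big [RHS]mulr_suml; apply: eq_bigr => j _; have [sp _ p1] := pP j.
by rewrite sumrN nodesP // p1 mulNr opprK.
Qed.

Lemma euler_wedge D q (t : q.-tuple coordinate) :
  (forall i, ((tnth t i).2 <= D)%N) -> euler D (wedge t) = weight t *: wedge t.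
Proof.
move=> tD; rewrite wedgeE euler_sum scaler_sumr; apply: eq_bigr => s _.
rewrite eulerZ euler_monomial ?weight_perm ?scalerA 1?mulrC // => i.
by rewrite tnth_mktuple.
Qed.

Definition bounded D q (s : seq (K * q.-tuple coordinate)) : Prop :=
  forall p, p \in s -> forall i, ((tnth p.2 i).2 <= D)%N.

Lemma bounded_exists q (s : seq (K * q.-tuple coordinate)) :
  exists D0, forall D, (D0 <= D)%N -> bounded D s.
Proof.
elim: s => [|p s [D0 sD0]]; first by exists 0%N.
exists (maxn D0 (\max_i (tnth p.2 i).2)) => D; rewrite geq_max => /andP[D0D pD] r.
rewrite inE => /predU1P[-> i|rs]; last exact: sD0.
exact: leq_trans (leq_bigmax i) pD.
Qed.

Lemma euler_combination D q (s : seq (K * q.-tuple coordinate)) : bounded D s ->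
  euler D (combination s) = combination [seq (p.1 * weight p.2, p.2) | p <- s].
Proof.
move=> sD; rewrite /combination euler_sum big_map big_seq [RHS]big_seq.
by apply: eq_bigr => p ps; rewrite eulerZ euler_wedge ?scalerA //; apply: sD.
Qed.

(** The coefficients after applying the product of the operators 1 - euler / w, for w in ws:
    when ws lists the nonzero weights this projects onto weight zero. *)
Definition damp (ws : seq K) q (s : seq (K * q.-tuple coordinate)) :=
  [seq (p.1 * \prod_(w <- ws) (1 - weight p.2 / w), p.2) | p <- s].

Lemma combination_damp0 q (s : seq (K * q.-tuple coordinate)) :
  combination (damp [::] s) = combination s.
Proof.
by rewrite /combination big_map; apply: eq_bigr => p _; rewrite big_nil mulr1.
Qed.

Lemma combination_damp D (ws : seq K) w q (s : seq (K * q.-tuple coordinate)) :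
  bounded D s -> combination (damp (w :: ws) s)
    = combination (damp ws s) - w^-1 *: euler D (combination (damp ws s)).
Proof.
move=> sD; rewrite euler_combination; last first.
  by move=> p /mapP[r rs ->] i; apply: (sD r rs i).
rewrite combinationZ /combination !big_map -sumrB; apply: eq_bigr => p _ /=.
rewrite big_cons -scalerBl; congr (_ *: _); ring.
Qed.

Lemma damp_weights q (s : seq (K * q.-tuple coordinate)) :
  combination (damp [seq weight p.2 | p <- s & weight p.2 != 0] s)
    = combination [seq p <- s | weight p.2 == 0].
Proof.
rewrite /combination big_map big_filter [RHS]big_mkcond big_seq [RHS]big_seq.
apply: eq_bigr => p ps /=; case: eqP => [->|/eqP p0].
  by rewrite big1 ?mulr1 // => w _; rewrite mul0r subr0.
rewrite (big_rem (weight p.2)) /=; last by apply: map_f; rewrite mem_filter p0.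
by rewrite divff // subrr mul0r mulr0 scale0r.
Qed.

Definition weightless q (s : seq (K * q.-tuple coordinate)) : Prop :=
  forall p, p \in s -> weight p.2 = 0.

(** The Euler operator commutes with d, hence kills d of a weightless combination; applying
    the projection onto weight zero then changes nothing. *)
Theorem diff_weightless q (s : seq (K * q.-tuple coordinate)) : weightless s ->
  exists2 s' : seq (K * q.+1.-tuple coordinate), weightless s' &
    diff (combination s) = combination s'.
Proof.
move=> ws; have [s' sE] := cochain_combinationP (cochain_diff (cochain_combination s)).
have [D0 sD0] := bounded_exists s; have [D1 sD1] := bounded_exists s'.
pose D := maxn D0 D1.
have sD : bounded D s by apply/sD0/leq_maxl.
have s'D : bounded D s' by apply/sD1/leq_maxr.
have e0 : euler D (combination s') = 0.
  rewrite -sE -diff_euler; last exact/cochain_form/cochain_combination.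
  rewrite euler_combination // /combination big_map big_seq big1 ?diff0 // => p ps.
  by rewrite ws // mulr0 scale0r.
exists [seq p <- s' | weight p.2 == 0]; first by move=> p; rewrite mem_filter => /andP[/eqP].
rewrite -damp_weights sE; elim: [seq _ | p <- s' & _] => [|w r IHr].
  by rewrite combination_damp0.
by rewrite (combination_damp _ _ s'D) -IHr e0 scaler0 subr0.
Qed.

(** Each operator 1 - euler / w changes g by - euler g / w.  As the Euler operator commutes
    with d and kills d g, this does not change d g; and if d g = 0, then euler g is a
    coboundary. *)
Theorem weight_zero_part q (g : precochain T q.+1) (s' : seq (K * q.+2.-tuple coordinate)) :
  cochain g -> diff g = combination s' -> weightless s' ->
  exists s : seq (K * q.+1.-tuple coordinate), [/\ weightless s, diff (combination s) = diff g
    & diff g = 0 -> exists2 b, cochain b & g - combination s = diff b].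
Proof.
move=> /cochain_combinationP[s ->] ds ws'.
have [D0 sD0] := bounded_exists s; have [D1 sD1] := bounded_exists s'.
pose D := maxn D0 D1.
have sD : bounded D s by apply/sD0/leq_maxl.
have s'D : bounded D s' by apply/sD1/leq_maxr.
have e0 : euler D (diff (combination s)) = 0.
  rewrite ds euler_combination // /combination big_map big_seq big1 // => p ps.
  by rewrite ws' // mulr0 scale0r.
pose ws := [seq weight p.2 | p <- s & weight p.2 != 0].
have [dd H] : diff (combination (damp ws s)) = diff (combination s) /\
    (diff (combination s) = 0 ->
      exists2 b, cochain b & combination s - combination (damp ws s) = diff b).
  elim: ws => [|w ws [dd H]].
    rewrite combination_damp0; split=> // _.
    by exists 0; [exact: cochain0 | rewrite subrr diff0].
  have cd := cochain_combination (damp ws s).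
  rewrite (combination_damp _ _ sD); split.
    rewrite diffB diffZ diff_euler ?dd ?e0 ?scaler0 ?subr0 //.
    exact: cochain_form.
  move=> d0; have [b cb bE] := H d0.
  have [|b' cb' b'E] := euler_exact D cd; first by rewrite dd.
  exists (b + w^-1 *: b'); first exact/cochainD/cochainZ.
  by rewrite opprB addrCA addrC diffD diffZ -bE -b'E.
exists [seq p <- s | weight p.2 == 0]; split.
- by move=> p; rewrite mem_filter => /andP[/eqP].
- by rewrite -damp_weights.
- by move/H => [b cb bE]; exists b; rewrite -?damp_weights.
Qed.

End Weights.

(** * Explicit evaluation *)
Local Notation L0 := ((true, 0%N) : coordinate).
Local Notation L1 := ((true, 1%N) : coordinate).
Local Notation L2 := ((true, 2%N) : coordinate).
Local Notation M0 := ((false, 0%N) : coordinate).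
Local Notation M1 := ((false, 1%N) : coordinate).

Section Evaluation.
Variable K : numFieldType.
Local Notation T := (trivialMod K).
Local Notation A := (HV K).

(** Arguments indexed by natural numbers, and determinants and differentials defined by
    recursion, let simplification expand a concrete instance completely. *)
Fixpoint alt_sum n (F : nat -> K) : K :=
  if n is n'.+1 then F 0%N - alt_sum n' (fun i => F i.+1) else 0.

Lemma alt_sumE n F : alt_sum n F = \sum_(i < n) (-1) ^+ i * F i.
Proof.
elim: n F => [|n IHn] F /=; first by rewrite big_ord0.
rewrite big_ord_recl expr0 mul1r IHn -sumrN; congr (_ + _).
by apply: eq_bigr => i _; rewrite exprS mulN1r mulNr.
Qed.

(** [bump], in a form that reduces on numerals. *)
Fixpoint skip (h k : nat) : nat :=
  if h is h'.+1 then if k is k'.+1 then (skip h' k').+1 else 0%N else k.+1.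

Lemma skipE h k : skip h k = bump h k.
Proof. by elim: h k => [|h IHh] [|k] //=; rewrite IHh /bump ltnS addnS. Qed.

Fixpoint nat_det n (M : nat -> nat -> K) : K :=
  if n is n'.+1 then
    alt_sum n (fun i => M 0%N i * nat_det n' (fun j k => M j.+1 (skip i k)))
  else 1.

Lemma nat_detE n (M : nat -> nat -> K) : \det (\matrix_(j < n, i < n) M j i) = nat_det n M.
Proof.
elim: n M => [|n IHn] M; first by rewrite det_mx00.
rewrite (expand_det_row _ ord0) /nat_det -/nat_det alt_sumE; apply: eq_bigr => i _.
rewrite mxE mulrCA /cofactor add0n -IHn; congr (_ * (_ * \det _)).
by apply/matrixP => j k; rewrite !mxE skipE.
Qed.

Definition nat_cons U (u : U) (f : nat -> U) (k : nat) : U := if k is k'.+1 then f k' else u.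

Lemma fcons_nat U n (u : U) (f : nat -> U) :
  fcons u (fun i : 'I_n => f i) = (fun i : 'I_n.+1 => nat_cons u f i).
Proof. by apply: ord_funP => [|j]; rewrite ?fcons0 ?fconsS. Qed.

Lemma nat_precochainP n (f g : precochain T n.+1) :
  (forall (a : nat -> A) (x : nat -> K), f (fun i => a i) (fun i => x i)
     = g (fun i => a i) (fun i => x i)) -> f = g.
Proof.
move=> fg; apply: precochainP => a x.
have nat_fun U (u : 'I_n.+1 -> U) : u = (fun i => u (inord (nat_of_ord i))).
  by apply/funext => i; rewrite inord_val.
by rewrite (nat_fun _ a) (nat_fun _ x) (fg (fun k => a (inord k)) (fun k => x (inord k))).
Qed.

Lemma wedge_nat q (t : q.-tuple coordinate) (a : nat -> A) (x : nat -> K) :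
  wedge t (fun i => a i) (fun i => x i)
    = nat_det q (fun j i => coord_eval (nth (true, 0%N) t i) (a j) (x j)).
Proof.
rewrite -nat_detE /wedge; congr (\det _); apply/matrixP => j i.
by rewrite !mxE (tnth_nth (true, 0%N)).
Qed.

Lemma diff_nat n (g : precochain T n.+1) (a : nat -> A) (x : nat -> K) :
  diff g (fun i => a i) (fun i => x i) =
  - alt_sum n.+2 (fun i => alt_sum n.+1 (fun j => if (i <= j)%N then
    g (fun k => nat_cons (HVbr (x i) (a i) (a j.+1)) (fun k => a (skip i (skip j k))) k)
      (fun k => nat_cons (x i + x j.+1) (fun k => x (skip i (skip j k))) k) else 0)).
Proof.
rewrite alt_sumE -sumrN; transitivity (diff_br g (fun i => a i) (fun i => x i)).
  by rewrite /= trivial_diff add0r.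
apply: eq_bigr => i _; rewrite alt_sumE mulr_sumr -sumrN big_mkcond.
apply: eq_bigr => j _; case: ifP => ij.
  have bS : bump i j = j.+1 by rewrite /bump ij.
  rewrite /= bS addnS mulrA -exprD -mulNr -[X in X * _]mulN1r -exprS.
  rewrite -!fcons_nat; congr (_ * g (fcons _ _) (fcons _ _));
    by apply/funext => k; rewrite /= !skipE.
by rewrite !mulr0 oppr0.
Qed.

(** der becomes - x - y in [a_x b]. *)
Lemma coord_eval_br (t : coordinate) (a b : HVsort K) (x y : K) :
  coord_eval t (HVbr x a b) (x + y) =
  (if t.1 then a.1.[- x] * b.1.[- y] * (x - y)
   else x * (a.2.[- x] * b.1.[- y]) - y * (a.1.[- x] * b.2.[- y])) * (x + y) ^+ t.2.
Proof.
have X : - (x + y) + x = - y by ring.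
case: t => [[] m]; rewrite /coord_eval /sesqui /= !(hornerE, horner_comp) /= X; ring.
Qed.


Local Ltac wedge_ring :=
  rewrite /= !wedge_nat /= ?coord_eval_br /coord_eval /=; ring.

Lemma diff_L1 : diff (wedge [tuple L1] : precochain T 1) = wedge [tuple L0; L2].
Proof. by apply: nat_precochainP => a x; rewrite diff_nat; wedge_ring. Qed.

Lemma diff_M0 : diff (wedge [tuple M0] : precochain T 1) = wedge [tuple L0; M1].
Proof. by apply: nat_precochainP => a x; rewrite diff_nat; wedge_ring. Qed.

Lemma diff_L1M0 : diff (wedge [tuple L1; M0] : precochain T 2)
  = wedge [tuple L0; L2; M0] - wedge [tuple L0; M1; L1].
Proof.
apply: nat_precochainP => a x; rewrite diff_nat precochainD precochainN; wedge_ring.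
Qed.

Lemma diff_L0L2L1 : diff (wedge [tuple L0; L2; L1] : precochain T 3) = 0.
Proof.
apply: nat_precochainP => a x; rewrite diff_nat [RHS](_ : _ = 0) //; wedge_ring.
Qed.

Lemma diff_L0L2M0 : diff (wedge [tuple L0; L2; M0] : precochain T 3) = 0.
Proof.
apply: nat_precochainP => a x; rewrite diff_nat [RHS](_ : _ = 0) //; wedge_ring.
Qed.

Lemma diff_L0M1M0 : diff (wedge [tuple L0; M1; M0] : precochain T 3) = 0.
Proof.
apply: nat_precochainP => a x; rewrite diff_nat [RHS](_ : _ = 0) //; wedge_ring.
Qed.

Lemma diff_L0M1L1 : diff (wedge [tuple L0; M1; L1] : precochain T 3) = 0.
Proof.
apply: nat_precochainP => a x; rewrite diff_nat [RHS](_ : _ = 0) //; wedge_ring.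
Qed.

End Evaluation.

(** * Weightless exterior products *)
Section Canonical.
Variable K : numFieldType.
Local Notation T := (trivialMod K).

(** The subsets of {L_1, M_0}, alone or multiplied by L_0 L_2 or by L_0 M_1. *)
Definition canonical : seq (seq coordinate) :=
  [:: [::]; [:: L1]; [:: M0]; [:: L1; M0];
      [:: L0; L2]; [:: L0; L2; L1]; [:: L0; L2; M0]; [:: L0; L2; L1; M0];
      [:: L0; M1]; [:: L0; M1; L1]; [:: L0; M1; M0]; [:: L0; M1; L1; M0]].

Definition light : seq coordinate := [:: L0; L2; M1; L1; M0].

(** The weight of a coordinate is t.2 - t.1; truncation changes it only for L_0, from -1
    to 0. *)
Lemma sum_excess (s : seq coordinate) :
  (sumn [seq t.2 | t <- s] + count_mem L0 s
     = count fst s + sumn [seq t.2 - nat_of_bool t.1 | t <- s])%N.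
Proof.
elim: s => [//|[[] [|m]] s]; rewrite /= ?xpair_eqE /=;
  move: (sumn _) (count_mem _ s) (count fst s) (sumn _) => n1 n2 n3 n4; lia.
Qed.

(** L_0, which occurs at most once, contributes -1; the other weights are nonnegative and
    have to sum up to at most 1. *)
Lemma weightless_light (s : seq coordinate) : uniq s ->
  sumn [seq t.2 | t <- s] = count fst s -> {subset s <= light}.
Proof.
move=> us ws t ts; have := sum_excess s; rewrite ws count_uniq_mem // => /addnI e1.
have: (t.2 - t.1 <= 1)%N.
  apply: leq_trans (leq_b1 (L0 \in s)); rewrite e1.
  by rewrite (perm_sumn (perm_map _ (perm_to_rem ts))) leq_addr.
by case: t {ts} => [[] [|[|[|m]]]].
Qed.

Lemma weightless_canonical (s : seq coordinate) : uniq s ->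
  sumn [seq t.2 | t <- s] = count fst s ->
  exists2 l, l \in canonical & perm_eq s l.
Proof.
move=> us ws; have sl := weightless_light us ws.
have pl : perm_eq s [seq t <- light | t \in s].
  apply: uniq_perm => [//||t]; first exact: filter_uniq.
  rewrite mem_filter.
  by case ts: (t \in s) => //=; apply/esym/sl.
exists [seq t <- light | t \in s] => //.
(* Of the 32 subsets of light, only the 12 canonical ones are balanced. *)
move: ws; rewrite (perm_sumn (perm_map _ pl)) (seq.permP pl fst) /=.
by do 5!case: (_ \in s).
Qed.

Lemma weight_nat q (t : q.-tuple coordinate) : weight K t = 0 ->
  sumn [seq u.2 | u <- t] = count fst t.
Proof.
rewrite /weight => w0; apply/eqP; rewrite -(eqr_nat K) -subr_eq0; apply/eqP.
rewrite -[RHS]w0 -(big_tuple _ _ t xpredT (@coord_weight K)).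
elim: {w0} (tval t) => [|u s IHs]; first by rewrite big_nil subrr.
by rewrite big_cons /= !natrD opprD addrACA IHs.
Qed.

Definition canonical_tuples q : seq (q.-tuple coordinate) := pmap insub canonical.

Lemma wedge_weightless q (t : q.-tuple coordinate) : weight K t = 0 ->
  exists c : q.-tuple coordinate -> K,
    wedge t = \sum_(l <- canonical_tuples q) c l *: wedge l :> precochain T q.
Proof.
move=> /weight_nat wt; case ut: (uniq t); last first.
  exists (fun=> 0); rewrite wedge_repeat ?ut // big1 // => l _; exact: scale0r.
have [l lc tl] := weightless_canonical ut wt.
have sl : size l == q by rewrite -(perm_size tl) size_tuple.
have [s sE] := tuple_permP (tl : perm_eq t (Tuple sl)).
have -> : t = [tuple tnth (Tuple sl) (s i) | i < q] by apply: val_inj.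
exists (fun l' => if l' == Tuple sl then (-1) ^+ s else 0); rewrite wedge_perm.
have uc : uniq (canonical_tuples q) by apply: pmap_sub_uniq.
rewrite (bigD1_seq (Tuple sl)) //=; last first.
  by rewrite mem_pmap_sub.
rewrite eqxx big1 ?addr0 // => l' /negbTE ->; exact: scale0r.
Qed.

Theorem combination_weightless q (s : seq (K * q.-tuple coordinate)) : weightless s ->
  exists c : q.-tuple coordinate -> K,
    combination s = \sum_(l <- canonical_tuples q) c l *: wedge l :> precochain T q.
Proof.
elim: s => [|p s IHs] ws.
  exists (fun=> 0); rewrite /combination big_nil big1 // => l _; exact: scale0r.
have [|c cE] := IHs; first by move=> r rs; apply: ws; rewrite inE rs orbT.
have [c' c'E] := wedge_weightless (ws p (mem_head _ _)).
exists (fun l => p.1 * c' l + c l); rewrite /combination big_cons -/(combination s) cE c'E.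
rewrite scaler_sumr -big_split; apply: eq_bigr => l _ /=.
by rewrite scalerDl scalerA.
Qed.

Lemma canonical_tuplesE q (s : seq (q.-tuple coordinate)) :
  [seq val l | l <- s] = [seq l <- canonical | size l == q] -> canonical_tuples q = s.
Proof.
by move=> sE; apply: (inj_map val_inj); rewrite sE (pmap_filter (@insubK _ _ _));
  apply: eq_filter => l /=; rewrite isSome_insub.
Qed.

Lemma canonical_tuples_large q : (4 < q)%N -> canonical_tuples q = [::].
Proof. by move=> q4; apply: canonical_tuplesE; move: q q4; do 5 case=> //. Qed.

End Canonical.

(** * Basic cohomology of the trivial module *)
Section BasicCohomology.
Variable K : numFieldType.
Local Notation T := (trivialMod K).
Local Notation wedge := (@wedge K _).

Lemma closed_canonical q (g : precochain T q.+1) : cochain g -> diff g = 0 ->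
  exists c b, [/\ cochain b, diff (\sum_(l <- canonical_tuples q.+1) c l *: wedge l) = 0
    & g - \sum_(l <- canonical_tuples q.+1) c l *: wedge l = diff b].
Proof.
move=> cg dg; have d0 : diff g = combination [::] by rewrite dg /combination big_nil.
have [|s [ws ds H]] := weight_zero_part cg d0; first by [].
have [b cb bE] := H dg; have [c cE] := combination_weightless ws.
by exists c, b; rewrite -cE ds dg; split.
Qed.

Lemma exact_canonical q (g : precochain T q.+1) (s : seq (K * q.+2.-tuple coordinate)) :
  cochain g -> diff g = combination s -> weightless s ->
  exists c, diff (\sum_(l <- canonical_tuples q.+1) c l *: wedge l) = diff g.
Proof.
move=> cg dg ws; have [s' [ws' ds' _]] := weight_zero_part cg dg ws.
by have [c cE] := combination_weightless ws'; exists c; rewrite -cE.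
Qed.

Lemma canonical1 : canonical_tuples 1 = [:: [tuple L1]; [tuple M0]].
Proof. exact: canonical_tuplesE. Qed.

Lemma canonical2 : canonical_tuples 2 = [:: [tuple L1; M0]; [tuple L0; L2]; [tuple L0; M1]].
Proof. exact: canonical_tuplesE. Qed.

Lemma canonical3 : canonical_tuples 3 =
  [:: [tuple L0; L2; L1]; [tuple L0; L2; M0]; [tuple L0; M1; L1]; [tuple L0; M1; M0]].
Proof. exact: canonical_tuplesE. Qed.

Lemma canonical4 : canonical_tuples 4 = [:: [tuple L0; L2; L1; M0]; [tuple L0; M1; L1; M0]].
Proof. exact: canonical_tuplesE. Qed.

(** The linear forms by which exterior products are told apart: sampling at k copies of L
    kills the products with a different number of factors L_m, and among the others the
    choice of xs isolates one coefficient. *)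
Definition sample (bs : seq bool) (xs : seq K) n (g : precochain T n) : K :=
  g (fun i => HVgen K (nth true bs i)) (fun i => nth 0 xs i).

Lemma sampleD bs xs n (f g : precochain T n) :
  sample bs xs (f + g) = sample bs xs f + sample bs xs g.
Proof. by []. Qed.

Lemma sampleZ bs xs n k (f : precochain T n) : sample bs xs (k *: f) = k * sample bs xs f.
Proof. by []. Qed.

Lemma sample_wedge bs xs q (t : q.-tuple coordinate) : sample bs xs (wedge t) =
  nat_det q (fun j i => let u := nth (true, 0%N) t i in
    if u.1 == nth true bs j then nth 0 xs j ^+ u.2 else 0).
Proof.
rewrite /sample (wedge_nat t (fun j => HVgen K (nth true bs j)) (nth 0 xs)).
congr nat_det; apply/funext => j; apply/funext => i; rewrite /coord_eval /=.
by case: (nth _ t i) (nth true bs j) => [[] m] []; rewrite /= ?hornerC ?mul1r ?mul0r.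
Qed.

Local Ltac sample_wedges :=
  rewrite !(sampleD, sampleZ) !sample_wedge /=; ring.

Lemma free2 c1 c2 :
  c1 *: wedge [tuple L0; L2] + c2 *: wedge [tuple L0; M1] = 0 :> precochain T 2 ->
  c1 = 0 /\ c2 = 0.
Proof.
set z : precochain T 2 := _ + _ => z0; split.
  have <- : sample [:: true; true] [:: 0; 1] z = c1 by sample_wedges.
  by rewrite z0.
have <- : sample [:: true; false] [:: 0; 1] z = c2 by sample_wedges.
by rewrite z0.
Qed.

Lemma free3 c1 c2 c3 c4 :
  c1 *: wedge [tuple L0; L2; L1] + c2 *: wedge [tuple L0; L2; M0]
    + c3 *: wedge [tuple L0; M1; L1] + c4 *: wedge [tuple L0; M1; M0] = 0 :> precochain T 3 ->
  [/\ c1 = 0, c2 = 0, c3 = 0 & c4 = 0].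
Proof.
set z : precochain T 3 := _ + _ => z0.
have c1_0 : c1 = 0.
  have : sample [:: true; true; true] [:: 0; 1; -1] z = c1 * - 2%:R by sample_wedges.
  by rewrite z0 => /esym /eqP; rewrite mulf_eq0 oppr_eq0 pnatr_eq0 orbF => /eqP.
have c2_0 : c2 = 0.
  have <- : sample [:: true; true; false] [:: 0; 1; 0] z = c2 by sample_wedges.
  by rewrite z0.
have c4_0 : c4 = 0.
  have : sample [:: true; false; false] [:: 0; 0; 1] z = - c4 by sample_wedges.
  by rewrite z0 => /esym /eqP; rewrite oppr_eq0 => /eqP.
split=> //; have : sample [:: true; true; false] [:: 0; 1; 1] z = c2 - c3 by sample_wedges.
by rewrite z0 c2_0 sub0r => /esym /eqP; rewrite oppr_eq0 => /eqP.
Qed.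

Lemma free4 c1 c2 :
  c1 *: wedge [tuple L0; L2; L1; M0] + c2 *: wedge [tuple L0; M1; L1; M0] = 0
    :> precochain T 4 -> c1 = 0 /\ c2 = 0.
Proof.
set z : precochain T 4 := _ + _ => z0; split.
  have : sample [:: true; true; true; false] [:: 0; 1; -1; 0] z = c1 * - 2%:R by sample_wedges.
  by rewrite z0 => /esym /eqP; rewrite mulf_eq0 oppr_eq0 pnatr_eq0 orbF => /eqP.
have : sample [:: true; true; false; false] [:: 0; 1; 0; 1] z = c2 by sample_wedges.
by rewrite z0.
Qed.

Lemma weightless_cons q (t : q.-tuple coordinate) k (s : seq (K * q.-tuple coordinate)) :
  sumn [seq u.2 | u <- t] = count fst t -> weightless s -> weightless ((k, t) :: s).
Proof.
move=> wt ws p; rewrite inE => /predU1P[->|]; last exact: ws.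
apply/eqP; rewrite /weight /= -(big_tuple _ _ t xpredT (@coord_weight K)) sumrB subr_eq0.
move: wt; rewrite -sumn_count !sumnE !big_map => /(congr1 (fun n => n%:R : K)).
by rewrite !natr_sum => ->.
Qed.

Lemma basic_denP q (g : precochain T q.+1) :
  den (basicH T q.+1) g <-> exists2 b, cochain b & g = diff b.
Proof.
split=> [[b cb gb]|[b cb ->]]; exists b => //; last exact: subrr.
by apply/eqP; rewrite -subr_eq0; apply/eqP.
Qed.

Lemma basic0 : has_dim (basicH T 0) 1.
Proof.
exists (fun=> (fun _ _ => 1 : K^o) : precochain T 0); split.
- move=> _; split; last exact: trivial_diff.
  split=> [a|[]|[]|s a x] //; first exact: polyfun_cst.
  have -> : s = 1%g by apply/permP => -[].
  by rewrite odd_perm1 scale1r.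
- move=> k /(congr1 (fun g : precochain T 0 => g (fun=> 0) (fun=> 0))).
  by rewrite big_ord1 => k0 i; rewrite (ord1 i) -[LHS]mulr1; apply: k0.
- move=> g [_ _]; exists (fun=> g (fun=> 0) (fun=> 0)).
  rewrite big_ord1; apply: precochainP => a x.
  have -> : a = (fun=> 0) by apply/funext => -[].
  have -> : x = (fun=> 0) by apply/funext => -[].
  by rewrite precochainD precochainN precochainZ [_ *: _]mulr1 subrr.
Qed.

Lemma reduced0 : has_dim (reducedH T 0) 1.
Proof.
have [e [eN eF eS]] := basic0; exists e; split.
- move=> i; have [ce de] := eN i; split=> //; exists 0; first exact: cochain0.
  by rewrite cochain_partial0 de.
- move=> k [h _ hE]; apply: eF; apply: etrans (esym hE) _.
  by apply: precochainP => a x; rewrite trivial_partial big_ord0 mul0r.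
- move=> g [cg [h ch hE]].
  have dg : diff g = 0 by exact: trivial_diff.
  have [k kE] := eS g (conj cg dg); exists k, 0; first exact: cochain0.
  by rewrite cochain_partial0 kE.
Qed.

Lemma basic1 : has_dim (basicH T 1) 0.
Proof.
exists (fun=> 0); split=> [[]|k _ []|g [cg dg]] //.
have [c [b [cb]]] := closed_canonical cg dg; rewrite canonical1 !big_cons big_nil addr0.
rewrite diffD !diffZ diff_L1 diff_M0 => /free2[-> ->]; rewrite !scale0r addr0 subr0 => bE.
by exists (fun=> 0); rewrite big_ord0 subr0; exists b => //; rewrite bE /= subrr.
Qed.

Lemma diff_canonical2 c : diff (\sum_(l <- canonical_tuples 2) c l *: wedge l)
  = c [tuple L1; M0] *: wedge [tuple L0; L2; M0] - c [tuple L1; M0] *: wedge [tuple L0; M1; L1].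
Proof.
have dd1 : diff (wedge [tuple L0; L2]) = 0.
  by rewrite -diff_L1 diff_diff //; apply/cochain_form/cochain_wedge.
have dd2 : diff (wedge [tuple L0; M1]) = 0.
  by rewrite -diff_M0 diff_diff //; apply/cochain_form/cochain_wedge.
rewrite canonical2 !big_cons big_nil addr0 !diffD !diffZ dd1 dd2 !scaler0 !addr0.
by rewrite diff_L1M0 scalerBr.
Qed.

(** d (L_1 M_0) is nonzero, and L_0 L_2 = d L_1, L_0 M_1 = d M_0. *)
Lemma basic2 : has_dim (basicH T 2) 0.
Proof.
exists (fun=> 0); split=> [[]|k _ []|g [cg dg]] //.
have [c [b [cb]]] := closed_canonical cg dg; rewrite diff_canonical2 => dc.
have c0 : c [tuple L1; M0] = 0.
  have [|_ -> //] := @free3 0 (c [tuple L1; M0]) (- c [tuple L1; M0]) 0.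
  by rewrite !scale0r add0r addr0 scaleNr.
rewrite canonical2 !big_cons big_nil addr0 c0 scale0r add0r => bE.
exists (fun=> 0); rewrite big_ord0 subr0.
exists (b + (c [tuple L0; L2] *: wedge [tuple L1] + c [tuple L0; M1] *: wedge [tuple M0])).
  apply: cochainD => //; apply: cochainD; exact/cochainZ/cochain_wedge.
apply/eqP; rewrite subr_eq0 diffD -bE !diffD !diffZ diff_L1 diff_M0; apply/eqP.
by rewrite subrK.
Qed.

(** The four canonical products are closed, with one relation from d (L_1 M_0). *)
Lemma basic3 : has_dim (basicH T 3) 3.
Proof.
pose e := nth 0 [:: wedge [tuple L0; L2; L1]; wedge [tuple L0; L2; M0]; wedge [tuple L0; M1; M0]].
have eE (k : 'I_3 -> K) : \sum_i k i *: e i = k ord0 *: wedge [tuple L0; L2; L1]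
    + (k (lift ord0 ord0) *: wedge [tuple L0; L2; M0]
    + k (lift ord0 (lift ord0 ord0)) *: wedge [tuple L0; M1; M0]).
  by rewrite !big_ord_recl big_ord0 /= addr0.
exists (fun i => e i); split.
- case=> [[|[|[|//]]] lt_i3]; split; rewrite /e /=; try exact: cochain_wedge;
    [exact: diff_L0L2L1|exact: diff_L0L2M0|exact: diff_L0M1M0].
- move=> k /basic_denP[b cb kb].
  have [||c] := exact_canonical (s := [:: (k ord0, [tuple L0; L2; L1]);
      (k (lift ord0 ord0), [tuple L0; L2; M0]);
      (k (lift ord0 (lift ord0 ord0)), [tuple L0; M1; M0])]) cb.
    by rewrite -kb eE /combination !big_cons big_nil addr0.
    by do 3!apply: weightless_cons => //.
  rewrite -kb eE diff_canonical2; set c1 := c _ => kc.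
  have [|k0 k1 c0 k2] := @free3 (k ord0) (k (lift ord0 ord0) - c1) c1
      (k (lift ord0 (lift ord0 ord0))).
    rewrite scalerBl.
    rewrite -[RHS](subrr (c1 *: wedge [tuple L0; L2; M0] - c1 *: wedge [tuple L0; M1; L1])).
    by rewrite {1}kc opprB !addrA [LHS](ACl (1*2*5*4*3)).
  move: k1; rewrite c0 subr0 => k1 i.
  case: (unliftP ord0 i) => [i' ->|->] //; case: (unliftP ord0 i') => [i'' ->|->] //.
  by rewrite (ord1 i'').
- move=> g [cg dg]; have [c [b [cb _]]] := closed_canonical cg dg.
  rewrite canonical3 !big_cons big_nil addr0 => bE.
  pose k (i : 'I_3) := nth 0 [:: c [tuple L0; L2; L1];
    c [tuple L0; L2; M0] + c [tuple L0; M1; L1]; c [tuple L0; M1; M0]] i.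
  (* L_0 M_1 L_1 is cohomologous to L_0 L_2 M_0, the difference being d (L_1 M_0). *)
  exists k; apply/basic_denP; exists (b - c [tuple L0; M1; L1] *: wedge [tuple L1; M0]).
    by apply: cochainB => //; exact/cochainZ/cochain_wedge.
  rewrite diffB diffZ diff_L1M0 -bE eE /k /= scalerBr scalerDl !opprD opprK !addrA.
  by rewrite [RHS](ACl (1*2*3*6*5*(7*4))) /= subrr addr0.
Qed.

(** Both canonical products are closed, as there is none in degree 5; neither is exact, as
    those of degree 3 are closed. *)
Lemma basic4 : has_dim (basicH T 4) 2.
Proof.
pose e := nth 0 [:: wedge [tuple L0; L2; L1; M0]; wedge [tuple L0; M1; L1; M0]].
have eE (k : 'I_2 -> K) : \sum_i k i *: e i = k ord0 *: wedge [tuple L0; L2; L1; M0]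
    + k (lift ord0 ord0) *: wedge [tuple L0; M1; L1; M0].
  by rewrite !big_ord_recl big_ord0 /= addr0.
have d0 (t : 4.-tuple coordinate) : sumn [seq u.2 | u <- t] = count fst t -> diff (wedge t) = 0.
  move=> wt; have := @diff_weightless K _ [:: (1, t)]; rewrite /combination big_seq1 scale1r.
  case; first exact: weightless_cons.
  move=> s' /combination_weightless[c]; rewrite canonical_tuples_large // big_nil => cE.
  by move=> ->; apply: cE.
exists (fun i => e i); split.
- by case=> [[|[|//]] lt_i2]; split; rewrite /e /=; try exact: cochain_wedge; apply: d0.
- move=> k /basic_denP[b cb kb].
  have [||c] := exact_canonical (s := [:: (k ord0, [tuple L0; L2; L1; M0]);
      (k (lift ord0 ord0), [tuple L0; M1; L1; M0])]) cb.
    by rewrite -kb eE /combination !big_cons big_nil addr0.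
    by do 2!apply: weightless_cons => //.
  rewrite -kb eE canonical3 !big_cons big_nil addr0 !diffD !diffZ.
  rewrite diff_L0L2L1 diff_L0L2M0 diff_L0M1M0 diff_L0M1L1 !scaler0 !addr0 => /esym /free4[k0 k1] i.
  by case: (unliftP ord0 i) => [i' ->|->] //; rewrite (ord1 i').
- move=> g [cg dg]; have [c [b [cb _]]] := closed_canonical cg dg.
  rewrite canonical4 !big_cons big_nil addr0 => bE.
  exists (fun i => nth 0 [:: c [tuple L0; L2; L1; M0]; c [tuple L0; M1; L1; M0]] i).
  by apply/basic_denP; exists b => //; rewrite eE.
Qed.

Lemma basic_large q : has_dim (basicH T q.+4.+1) 0.
Proof.
exists (fun=> 0); split=> [[]|k _ []|g [cg dg]] //.
have [c [b [cb _]]] := closed_canonical cg dg.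
rewrite canonical_tuples_large // big_nil subr0 => bE.
by exists (fun=> 0); rewrite big_ord0 subr0; exists b => //; rewrite bE /= subrr.
Qed.

Theorem trivial_dims q :
  has_dim (basicH T q) (match q with 0 => 1 | 3 => 3 | 4 => 2 | _ => 0 end)%N /\
  has_dim (reducedH T q)
    (match q with 0 => 1 | 2 => 3 | 3 => 5 | 4 => 2 | _ => 0 end)%N.
Proof.
case: q => [|[|[|[|[|q]]]]]; split.
- exact: basic0.
- exact: reduced0.
- exact: basic1.
- exact: (reduced_of_basic basic1 basic2).
- exact: basic2.
- exact: (reduced_of_basic basic2 basic3).
- exact: basic3.
- exact: (reduced_of_basic basic3 basic4).
- exact: basic4.
- exact: (reduced_of_basic basic4 (basic_large 0)).
- exact: basic_large.
- exact: (reduced_of_basic (basic_large q) (basic_large q.+1)).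
Qed.

End BasicCohomology.


Theorem theorem2p6 (R : realType) :
  (forall q : nat,
     has_dim (basicH (trivialMod R[i]) q)
       (match q with 0 => 1 | 3 => 3 | 4 => 2 | _ => 0 end)%N /\
     has_dim (reducedH (trivialMod R[i]) q)
       (match q with 0 => 1 | 2 => 3 | 3 => 5 | 4 => 2 | _ => 0 end)%N) /\
  (forall (a : R[i]) (q : nat), a != 0 -> is_zero (reducedH (Cmod a) q)) /\
  (forall (Delta alpha : R[i]) (q : nat), alpha != 0 ->
     is_zero (reducedH (Mmod Delta alpha) q)).
Proof.
split; first exact: trivial_dims.
split=> [a q|Delta alpha q]; [exact: Cmod_vanish | exact: Mmod_vanish].
Qed.
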